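(* Let $d\ge1$, let $G=(V,E)$ be a $d$-connected chordal graph with $|V|\ge d+2$, and let $E'$ be a set of pairs of non-adjacent vertices of $G$. Let $G^*={\rm tlc}_d(G)$. Then the following are equivalent: (i) $G+E'$ is globally rigid in $\mathbb{R}^d$; (ii) $G+E'$ is $(d+1)$-connected; (iii) no $Q\in\mathcal{Q}_{G^*}$ is a cut vertex of the multigraph $T_{G^*}+T_{G^*}\langle E'\rangle$.
   Context: A $d$-dimensional framework is a pair $(G,p)$ with $G=(V,E)$ a graph and $p:V\to\mathbb{R}^d$; it is generic if its $d|V|$ coordinates are algebraically independent over $\mathbb{Q}$. Frameworks $(G,p),(G,q)$ are equivalent if $\|p(u)-p(v)\|=\|q(u)-q(v)\|$ for all $uv\in E$, and congruent if this holds for all $u,v\in V$. $(G,p)$ is globally rigid if every equivalent $d$-dimensional framework is congruent to it; a graph is globally rigid in $\mathbb{R}^d$ if some (equivalently, every) generic realization in $\mathbb{R}^d$ is globally rigid. A vertex pair $\{u,v\}$ is weakly globally linked in $G$ in $\mathbb{R}^d$ if there is a generic realization $(G,p)$ in $\mathbb{R}^d$ such that every equivalent $d$-dimensional $(G,q)$ satisfies $\|q(u)-q(v)\|=\|p(u)-p(v)\|$; otherwise it is globally loose. $G$ is totally loose in $\mathbb{R}^d$ if every non-adjacent pair is globally loose in $G$. The totally loose closure ${\rm tlc}_d(G)$ is the unique minimal totally loose in $\mathbb{R}^d$ supergraph of $G$ on vertex set $V$; for a $d$-connected chordal $G$, ${\rm tlc}_d(G)$ is again a $d$-connected chordal graph.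 For a totally loose $d$-connected chordal graph $G^*$: $\mathcal{S}_{G^*}$ is the set of maximal cliques of $G^*$ and $\mathcal{Q}_{G^*}$ the set of $d$-separators (vertex sets of size $d$ whose removal disconnects $G^*$). The tree representation $T_{G^*}$ has node set $\mathcal{S}_{G^*}\cup\mathcal{Q}_{G^*}$, with $Q\in\mathcal{Q}_{G^*}$ adjacent to $S\in\mathcal{S}_{G^*}$ iff $Q\subseteq V(S)$; it is a tree. For a subgraph $T_0$ of $T_{G^*}$, $G^*[T_0]$ is the union of the subgraphs represented by the nodes of $T_0$. For non-adjacent $u,v$, let $P$ be the minimal path in $T_{G^*}$ with $u,v\in V(G^*[P])$, with end nodes $X,Y$; then $T_{G^*}\langle uv\rangle$ is the edge $XY$, and $T_{G^*}\langle E'\rangle=\{T_{G^*}\langle uv\rangle: uv\in E'\}$ (as a multiset). *)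

(* Defs.v *)
From mathcomp Require Import all_boot all_algebra.
From mathcomp Require Import Rstruct.
From mathcomp Require Import mpoly.
From Stdlib Require Import Relations.Relation_Operators.
Import GRing.Theory Num.Theory.

Set Implicit Arguments.
Unset Strict Implicit.
Unset Printing Implicit Defensive.

Local Open Scope ring_scope.

Notation R := Rdefinitions.R.

Section Defs.
Variable V : finType.

Definition simple_graph (E : {set {set V}}) : Prop :=
  forall e, e \in E -> #|e| = 2%N.

Definition adj (E : {set {set V}}) (u v : V) : bool := [set u; v] \in E.

Definition add_edges (E E' : {set {set V}}) : {set {set V}} := E :|: E'.

Definition reach_in (T : Type) (r : T -> T -> Prop) (S : T -> Prop) (x y : T) :=
  clos_refl_trans T (fun a b => S a /\ S b /\ r a b) x y.

Definition connected_on (E : {set {set V}}) (S : {set V}) : Prop :=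
  forall u v, u \in S -> v \in S -> reach_in (fun a b => adj E a b) (fun a => a \in S) u v.

Definition k_connected (k : nat) (E : {set {set V}}) : Prop :=
  (k < #|V|)%N /\ forall X : {set V}, (#|X| < k)%N -> connected_on E (~: X).

Definition chordal (E : {set {set V}}) : Prop :=
  forall (x : V) (c : seq V), uniq (x :: c) -> (4 <= size (x :: c))%N ->
    cycle (adj E) (x :: c) ->
    exists i j : nat, [/\ (i < j)%N, (j < size (x :: c))%N, j != i.+1,
      ~~ ((i == 0%N) && (j == size c)) &
      adj E (nth x (x :: c) i) (nth x (x :: c) j)].

Definition config (d : nat) := V -> 'rV[R]_d.

Definition eucl_dist (d : nat) (x y : 'rV[R]_d) : R :=
  Num.sqrt (\sum_(k < d) (x 0 k - y 0 k) ^+ 2).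

Definition coords (d : nat) (p : config d) : 'I_#|{: V * 'I_d}| -> R :=
  fun i => let vk := enum_val i in p vk.1 0 vk.2.

Definition alg_indep_Q (n : nat) (x : 'I_n -> R) : Prop :=
  forall P : {mpoly rat[n]}, (map_mpoly (ratr : rat -> R) P).@[x] = 0 -> P = 0.

Definition generic (d : nat) (p : config d) : Prop := alg_indep_Q (coords p).

Definition equivalent (d : nat) (E : {set {set V}}) (p q : config d) : Prop :=
  forall u v, adj E u v -> eucl_dist (p u) (p v) = eucl_dist (q u) (q v).

Definition congruent (d : nat) (p q : config d) : Prop :=
  forall u v, eucl_dist (p u) (p v) = eucl_dist (q u) (q v).

Definition framework_globally_rigid (d : nat) (E : {set {set V}}) (p : config d) : Prop :=
  forall q : config d, equivalent E p q -> congruent p q.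

Definition globally_rigid (d : nat) (E : {set {set V}}) : Prop :=
  exists p : config d, generic p /\ framework_globally_rigid E p.

Definition weakly_globally_linked (d : nat) (E : {set {set V}}) (u v : V) : Prop :=
  exists p : config d, generic p /\
    forall q : config d, equivalent E p q ->
      eucl_dist (q u) (q v) = eucl_dist (p u) (p v).

Definition globally_loose (d : nat) (E : {set {set V}}) (u v : V) : Prop :=
  ~ weakly_globally_linked d E u v.

Definition totally_loose (d : nat) (E : {set {set V}}) : Prop :=
  forall u v, u != v -> ~~ adj E u v -> globally_loose d E u v.

(* Gs is the totally loose closure tlc_d(E): the least (= unique minimal)
   totally loose simple supergraph of E on the same vertex set *)
Definition is_tlc (d : nat) (E Gs : {set {set V}}) : Prop :=
  [/\ simple_graph Gs, E \subset Gs, totally_loose d Gs &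
      forall H, simple_graph H -> E \subset H -> totally_loose d H -> Gs \subset H].

Definition clique (E : {set {set V}}) (K : {set V}) : bool :=
  [forall u in K, forall v in K, (u != v) ==> adj E u v].

Definition max_clique (E : {set {set V}}) (K : {set V}) : bool :=
  maxset (clique E) K.

Definition separator (d : nat) (E : {set {set V}}) (Q : {set V}) : Prop :=
  #|Q| = d /\ ~ connected_on E (~: Q).

(* nodes: (true, S) for a maximal clique S, (false, Q) for a d-separator Q *)
Definition tnode := (bool * {set V})%type.

Definition is_tnode (d : nat) (E : {set {set V}}) (x : tnode) : Prop :=
  if x.1 then is_true (max_clique E x.2) else separator d E x.2.

Definition tadj (d : nat) (E : {set {set V}}) (x y : tnode) : Prop :=
  [/\ is_tnode d E x, is_tnode d E y & 
      (x.1 && ~~ y.1 && (y.2 \subset x.2)) || (~~ x.1 && y.1 && (x.2 \subset y.2))].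

Definition tpath (d : nat) (E : {set {set V}}) (P : seq tnode) : Prop :=
  [/\ P != [::], uniq P, forall x, x \in P -> is_tnode d E x &
      forall i, (i.+1 < size P)%N ->
        tadj d E (nth (true, set0) P i) (nth (true, set0) P i.+1)].

Definition covers (P : seq tnode) (w : V) : Prop := exists2 x, x \in P & w \in x.2.

Definition min_cover_path (d : nat) (E : {set {set V}}) (u v : V) (P : seq tnode) : Prop :=
  [/\ tpath d E P, covers P u, covers P v &
      forall P', tpath d E P' -> covers P' u -> covers P' v ->
        {subset P' <= P} -> {subset P <= P'}].

Definition tl_edge (d : nat) (E : {set {set V}}) (u v : V) (X Y : tnode) : Prop :=
  exists P, [/\ min_cover_path d E u v P, head (true, set0) P = X &
                last (true, set0) P = Y].

(* adjacency in the multigraph T_G + T_G<E'> (multiplicities are irrelevant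
   for cut vertices) *)
Definition madj (d : nat) (E E' : {set {set V}}) (x y : tnode) : Prop :=
  tadj d E x y \/
  exists u v, [set u; v] \in E' /\ (tl_edge d E u v x y \/ tl_edge d E u v y x).

Definition cut_vertex (T : Type) (N : T -> Prop) (r : T -> T -> Prop) (z : T) : Prop :=
  N z /\ exists x y, [/\ N x /\ N y, x <> z, y <> z, reach_in r N x y &
                         ~ reach_in r (fun a => N a /\ a <> z) x y].

End Defs.

(* Main.v *)
(* Let [p] be generic and [q] equivalent to [p] on [E], and call a pair preserved if its distance
   is the same in [p] and in [q]. Eliminate the simplicial vertices [s] of [E] one at a time. By an
   isometry [q] can be made to agree with [p] on [s] and its remaining neighbours, and then the
   [q]-positions of the remaining vertices are rational functions of their [p]-positions. If [sv] is
   preserved, this yields an affine equation for the generic point [p s] over the field generated by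
   the other positions, so its coefficients vanish and [q v = p v]. Hence [s] is simplicial in the
   graph of preserved pairs as well, and inductively every pair that is not preserved is separated
   by [d] vertices in that graph. So (d+1)-connectivity implies global rigidity. Conversely, a
   reflection of one side of a [d]-separator destroys it. For [E] itself this shows that the totally
   loose closure joins exactly the pairs which no [d] vertices separate in [E].

   For the tree, two maximal cliques [S] and [S'] of the closure are joined through [d]-separators
   that separate [S] from [S'] only (induction on the number of these), so that, apart from [Q], the
   components of the tree minus [Q] correspond to the components of the graph minus [Q]. *)
From Stdlib Require Reals Lra.
From Stdlib Require Import Classical ClassicalEpsilon FunctionalExtensionality.
From HB Require Import structures.
Require Import Defs.
From mathcomp Require Import all_boot all_order all_algebra.
From mathcomp Require Import Rstruct.
From mathcomp Require Import mpoly ring lra zify.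

Set Implicit Arguments.
Unset Strict Implicit.
Unset Printing Implicit Defensive.
Import Order.TTheory GRing.Theory Num.Theory.

(** * Chordal graphs and their separators *)

Section Connectivity.
Variable V : finType.
Implicit Types (e : rel V) (S W X : {set V}).

(** The boolean counterpart of [reach_in]. It is reflexive even at vertices outside [S], so
    membership in [S] has to be tracked separately. *)
Definition conn e S : rel V :=
  connect [rel a b | [&& a \in S, b \in S & e a b]].

Lemma conn1 e S a b : a \in S -> b \in S -> e a b -> conn e S a b.
Proof. by move=> aS bS ab; apply: connect1; rewrite /= aS bS. Qed.

Lemma conn_ind e S (P : V -> Prop) u :
    P u -> (forall a b, a \in S -> b \in S -> e a b -> P a -> P b) ->
  forall v, conn e S u v -> P v.
Proof.
move=> Pu step v /connectP[p]; elim: p u Pu => [|a p IH] u Pu /=.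
  by move=> _ ->.
case/andP=> /and3P[uS aS eua] pth lst; exact: IH (step _ _ uS aS eua Pu) pth lst.
Qed.

Lemma conn_trans e S : transitive (conn e S).
Proof. exact: connect_trans. Qed.

Lemma conn_sym e S : ssrbool.symmetric e -> ssrbool.symmetric (conn e S).
Proof.
move=> es; apply: sym_connect_sym => a b /=.
by rewrite es; case: (a \in S); case: (b \in S).
Qed.

Lemma conn_sub e e' S S' u v :
    S \subset S' -> {in S &, forall a b, e a b -> e' a b} ->
  conn e S u v -> conn e' S' u v.
Proof.
move=> sub ee'; move: v; apply: conn_ind => [|a b aS bS ab ua]; first exact: connect0.
apply: conn_trans ua _; apply: conn1; [exact: (subsetP sub)..|exact: ee'].
Qed.

Lemma conn_mem e S u v : u \in S -> conn e S u v -> v \in S.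
Proof. by move=> uS; move: v; apply: conn_ind. Qed.

Lemma reach_conn e S u v :
  reach_in (fun a b => e a b) (fun a => a \in S) u v <-> conn e S u v.
Proof.
split=> [|cuv].
  elim=> {u v} [a b [aS [bS ab]]|a|a b c _ ab _]; [exact: conn1|exact: connect0|].
  exact: conn_trans ab.
move: v cuv; apply: conn_ind => [|a b aS bS ab ua]; first exact: Relation_Operators.rt_refl.
by apply: Relation_Operators.rt_trans ua _; apply: Relation_Operators.rt_step.
Qed.

End Connectivity.

(** * Simplicial vertices of chordal graphs *)

Section Chordal.
Variables (V : finType) (e : rel V).
Implicit Types (A B C K N Q S W X : {set V}).
Hypothesis e_sym : ssrbool.symmetric e.

Definition chordal_rel := forall (x : V) (c : seq V), uniq (x :: c) ->
  (4 <= size (x :: c))%N -> cycle e (x :: c) ->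
  exists i j : nat, [/\ (i < j)%N, (j < size (x :: c))%N, j != i.+1,
    ~~ ((i == 0%N) && (j == size c)) &
    e (nth x (x :: c) i) (nth x (x :: c) j)].

Hypothesis ch : chordal_rel.

Lemma shortest_path (r : rel V) x y : connect r x y ->
  exists p, [/\ path r x p, y = last x p, uniq (x :: p) &
    forall p', path r x p' -> y = last x p' -> size p <= size p'].
Proof.
case/connectP=> p0 pth0 lst0.
pose P n := [exists p : n.-tuple V, path r x p && (y == last x p)].
have exP : exists n, P n.
  by exists (size p0); apply/existsP; exists (in_tuple p0); rewrite pth0 lst0 /=.
case: (ex_minnP exP) => n /existsP[[p /= /eqP szp] /andP[pth /eqP lst]] minn.
have minp p' : path r x p' -> y = last x p' -> size p <= size p'.
  move=> pth' lst'; rewrite szp; apply: minn; apply/existsP; exists (in_tuple p').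
  by rewrite /= pth' lst' /=.
case/shortenP: pth lst => p' pth' un sub lst.
exists p'; split=> // p'' pth'' lst''; apply: leq_trans (minp p'' pth'' lst'').
by apply: uniq_leq_size => //; case/andP: un.
Qed.

(* A shortest path from [x] to [y] through [A], closed up by [b], has no chord except [xy]. *)
Lemma chordal_cap A b x y :
    (forall a a', a \in A -> a' \in A -> conn e A a a') ->
    b \notin A -> {in A, forall a, ~~ e b a} ->
    x \notin A -> y \notin A -> x != y -> b != x -> b != y -> e b x -> e b y ->
    (exists2 a, a \in A & e x a) -> (exists2 a, a \in A & e y a) ->
  e x y.
Proof.
move=> cA bA bnA xA yA xy bx byy ebx eby [a aA xa] [a' a'A ya'].
apply: contraT => nexy.
(* A step of [r] must enter [A] or [y], so every vertex after [x] on such a path is in [A] or is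
   [y]. *)
pose r := [rel u v | e u v && ((v \in A) || (v == y))].
have : connect r x y.
  apply: (@connect_trans _ _ a); first by apply: connect1; rewrite /= xa aA.
  apply: (@connect_trans _ _ a'); last by apply: connect1; rewrite /= e_sym ya' eqxx orbT.
  move: (cA a a' aA a'A); apply: connect_sub => u v /= /and3P[uA vA euv].
  by apply: connect1; rewrite /= euv vA.
case/shortest_path=> p [pth lst un minp].
have pA z : z \in p -> (z \in A) || (z == y).
  move: pth; clear; elim: p x => //= t p IH x /andP[/andP[_ tA] pth].
  by rewrite inE => /predU1P[->|/(IH _ pth)].
have pe : path e x p by apply: sub_path pth => u v /= /andP[].
have szp : 1 < size p.
  case: p lst pe {un pth minp pA} => [lst|z [|z' p]] //=; first by rewrite lst eqxx in xy.
  by move=> <-; rewrite andbT => exy; rewrite exy in nexy.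
have bp : b \notin x :: p.
  rewrite inE (negbTE bx); apply/negP => /pA.
  by rewrite (negbTE bA) (negbTE byy).
have := ch (x := b) (c := x :: p).
case; first by rewrite cons_uniq bp un.
- by rewrite /= !ltnS.
- by rewrite /= ebx rcons_path pe -lst e_sym eby.
move=> i [j [ij]].
(* A chord at [b] cannot end in [A]; it would have to end at [y], which is the neighbour of [b] on
   the cycle. *)
case: i ij => [|i]; case: j => [//|j].
  move=> _ /= jsz j1 j2 ebj.
  case: j jsz j1 j2 ebj => [//|j] /=; rewrite !ltnS => jsz _ jne ebj.
  have jp : nth b p j \in p by rewrite mem_nth.
  case/orP: (pA _ jp) => [/bnA|/eqP Ey]; first by rewrite ebj.
  move: jne; rewrite eqSS; case/negP; apply/eqP.
  have yN : y = nth b p (size p).-1 by rewrite nth_last lst; case: (p) szp.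
  have : nth b p j == nth b p (size p).-1 by rewrite Ey {1}yN.
  have up : uniq p by case/andP: un.
  rewrite nth_uniq //; last by case: (p) szp.
  by move/eqP->; rewrite prednK // (leq_trans _ szp).
(* A chord between two vertices of the path yields the shorter path [take i p ++ drop j p], with the
   indices shifted past [b] and [x]. *)
rewrite ltnS /= ltnS => ij jsz; rewrite eqSS => jne _ eij.
case: j ij jsz jne eij => [//|j]; rewrite ltnS => ij; rewrite ltnS => jsz; rewrite eqSS => jne eij.
have {ij jne} ij : i < j by rewrite ltn_neqAle ij eq_sym jne.
have isz : i < size p by apply: ltn_trans ij _.
have dr : drop j p = nth b p j :: drop j.+1 p by rewrite (drop_nth b).
have lt : last x (take i p) = nth b (x :: p) i.
  rewrite (last_nth b) size_take isz -cat1s -(cat1s x p) !nth_cat /=.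
  by case: (i) => //= k; rewrite subSS subn0 nth_take.
have pj : path r (nth b p j) (drop j.+1 p).
  by move: pth; rewrite -{1}(cat_take_drop j p) cat_path dr /= => /and3P[].
have : size p <= size (take i p ++ drop j p).
  apply: minp.
    rewrite cat_path take_path //= dr /= pj andbT lt eij /=.
    by apply: pA; rewrite mem_nth.
  by rewrite last_cat dr /= lst -{1}(cat_take_drop j p) last_cat dr.
rewrite size_cat size_take isz size_drop => /leq_trans/(_ (leqnn _)).
by rewrite leqNgt addnC -ltn_subRL; rewrite subKn ?ij // ltnW.
Qed.

Definition simplicial W s :=
  s \in W /\ {in W &, forall a b, e s a -> e s b -> a != b -> e a b}.

Definition cliqueb K := [forall a in K, forall b in K, (a != b) ==> e a b].

Lemma cliqueP K : reflect {in K &, forall a b, a != b -> e a b} (cliqueb K).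
Proof.
apply: (iffP forall_inP) => [H a b aK bK|H a aK].
  by move/forall_inP: (H a aK) => /(_ b bK)/implyP.
by apply/forall_inP=> b bK; apply/implyP; apply: H.
Qed.

Lemma simplicial_sub W W' s : W' \subset W -> s \in W' -> simplicial W s -> simplicial W' s.
Proof.
move=> /subsetP sub sW' [_ H]; split=> // a b aW bW; exact: H (sub _ aW) (sub _ bW).
Qed.

(** Dirac's argument: take a maximal connected [A] containing [a] such that the set [B] of vertices
    neither in [A] nor adjacent to it is non-empty. A simplicial vertex [s] of [B] stays simplicial
    in [W]: the boundary vertices of [A] are joined to all of [B], and those adjacent to [s] are
    joined to each other by [chordal_cap] with [s] as cap. *)
Lemma simplicial_nonuniversal W a :
    (forall W', #|W'| < #|W| -> W' != set0 -> exists s, simplicial W' s) ->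
    a \in W -> (exists2 b, b \in W & (b != a) && ~~ e a b) ->
  exists2 s, simplicial W s & (s != a) && ~~ e a s.
Proof.
move=> IH aW [b bW bna].
pose nb A := [set z in W | [exists t in A, (z == t) || e t z]].
pose good A := [&& a \in A, A \subset W, W :\: nb A != set0 &
  [forall x in A, forall y in A, conn e A x y]].
have g0 : good [set a].
  apply/and4P; split; rewrite ?set11 ?sub1set //.
    apply/set0Pn; exists b; rewrite !inE bW andbT /=; apply/negP => /exists_inP[t].
    by rewrite inE => /eqP->; case/andP: bna => /negbTE-> /negbTE->.
  apply/forall_inP=> x /set1P->; apply/forall_inP => y /set1P->; exact: connect0.
case: (maxset_exists g0) => A /maxsetP[/and4P[aA AW Bn0 cA] maxA] _.
have cA' x y : x \in A -> y \in A -> conn e A x y.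
  by move=> xA; move/forall_inP: cA => /(_ x xA)/forall_inP; apply.
set B := W :\: nb A in Bn0.
have AnB : A \subset nb A.
  apply/subsetP=> x xA; rewrite inE (subsetP AW) //=; apply/exists_inP; exists x => //.
  by rewrite eqxx.
have BA t z : t \in A -> z \in B -> (z != t) && ~~ e t z.
  move=> tA; rewrite !inE => /andP[H zW]; rewrite -negb_or; apply: contra H => H.
  by rewrite zW; apply/exists_inP; exists t.
(* Maximality of [A] makes every boundary vertex adjacent to all of [B]. *)
have full x z : x \in nb A -> x \notin A -> z \in B -> e x z.
  move=> xN xA zB; apply: contraT => nxz.
  have : good (x |: A).
    have [xW /exists_inP[t tA]] : x \in W /\ [exists t in A, (x == t) || e t x].
      by move: xN; rewrite inE => /andP[].
    case/orP=> [/eqP E|tx]; first by rewrite E tA in xA.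
    apply/and4P; split.
    - by rewrite inE aA orbT.
    - by rewrite subUset sub1set xW.
    - apply/set0Pn; exists z; rewrite inE; apply/andP; split; last by move: zB; rewrite inE => /andP[].
      apply/negP; rewrite inE => /andP[_] /exists_inP[u].
      rewrite in_setU1 => /predU1P[->|uA]; last by apply/negP; rewrite negb_or BA.
      rewrite (negbTE nxz) orbF => /eqP E; move: zB; rewrite E inE xN //.
    - have st u v : conn e A u v -> conn e (x |: A) u v.
        by apply: conn_sub => //; apply: subsetUr.
      have sx u : u \in A -> conn e (x |: A) x u.
        move=> uA; apply: (@conn_trans _ _ _ t); last exact/st/cA'.
        by apply: conn1; rewrite ?inE ?eqxx ?tA ?orbT // e_sym.
      apply/forall_inP=> u uA; apply/forall_inP=> v vA; move: uA vA; rewrite !in_setU1.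
      move=> /predU1P[->|uA] /predU1P[->|vA]; [exact: connect0|exact: sx| |exact/st/cA'].
      rewrite conn_sym //; exact: sx.
  move/maxA => /(_ (subsetUr _ _)) E; by rewrite -E setU11 in xA.
have [||s [sB simp]] := IH B => //.
  apply: proper_card; apply/properP; split; first by rewrite subsetDl.
  by exists a => //; rewrite inE (subsetP AnB).
exists s; last exact: BA.
split; first by move: sB; rewrite inE => /andP[].
have nbs z : z \in W -> e s z -> (z \in B) || (z \in nb A) && (z \notin A).
  move=> zW sz; rewrite inE zW andbT; case zn: (z \in nb A) => //=.
  by apply: contraTN sz => zA; rewrite e_sym; case/andP: (BA z s zA sB).
have hasA z : z \in nb A -> z \notin A -> exists2 t, t \in A & e z t.
  rewrite inE => /andP[_ /exists_inP[t tA /orP[/eqP->|tz]]]; first by rewrite tA.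
  by exists t; rewrite // e_sym.
move=> x y xW yW sx sy xy.
case/orP: (nbs x xW sx) => [xB|/andP[xn xA]]; case/orP: (nbs y yW sy) => [yB|/andP[yn yA]].
- exact: simp.
- by rewrite e_sym; apply: full.
- exact: full.
have sA : s \notin A by apply/negP => sA; case/andP: (BA s s sA sB); rewrite eqxx.
apply: (@chordal_cap A s) => //.
- by move=> t tA; rewrite e_sym; case/andP: (BA t s tA sB).
- by apply/eqP=> E; move: sB; rewrite inE E xn.
- by apply/eqP=> E; move: sB; rewrite inE E yn.
- exact: hasA.
- exact: hasA.
Qed.

Lemma simplicial_exists W : W != set0 -> exists s, simplicial W s.
Proof.
elim: {W}_.+1 {-2}W (ltnSn #|W|) => // n IHn W; rewrite ltnS => szW.
have IH W' : #|W'| < #|W| -> W' != set0 -> exists s, simplicial W' s.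
  by move=> lt; apply: IHn; apply: leq_trans lt szW.
case/set0Pn=> a aW.
case ua: [exists b in W, (b != a) && ~~ e a b].
  have [s sW _] := simplicial_nonuniversal IH aW (exists_inP ua).
  by exists s.
have univ b : b \in W -> b != a -> e a b.
  move=> bW ba; apply: contraFT ua => nab; apply/exists_inP; exists b => //.
  by rewrite ba.
have [E|n0] := eqVneq (W :\ a) set0.
  have WE b : b \in W -> b = a.
    by move=> bW; apply: contraTeq isT => ba; move: (in_set0 b); rewrite -E in_setD1 ba bW.
  by exists a; split=> // x y /WE-> /WE->; rewrite eqxx.
have [||s [sW simp]] := IH (W :\ a) => //; first by rewrite [#|W|](cardsD1 a) aW.
exists s; case/setD1P: sW => sa sW; split=> // x y xW yW sx sy xy.
have [E|xa] := eqVneq x a; first by rewrite E univ // eq_sym -E.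
have [E|ya] := eqVneq y a; first by rewrite E e_sym univ.
by apply: simp => //; apply/setD1P.
Qed.

(** If some vertex of [K] misses a vertex of [W], there is a simplicial vertex not adjacent to it,
    hence outside [K]. Otherwise [K] is joined to everything and a simplicial vertex of [W :\: K]
    will do. *)
Lemma simplicial_off_clique W K : K \proper W -> cliqueb K ->
  exists2 s, simplicial W s & s \notin K.
Proof.
move=> /properP[KW [z zW zK]] /cliqueP cK.
case ua: [exists a in K, [exists b in W, (b != a) && ~~ e a b]].
  case/exists_inP: ua => a aK /exists_inP nu.
  have [||//|s sW /andP[sa nas]] := @simplicial_nonuniversal W a.
  - by move=> W' _; apply: simplicial_exists.
  - exact: (subsetP KW).
  by exists s => //; apply: contra nas => sK; apply: cK => //; rewrite eq_sym.
have univ a b : a \in K -> b \in W -> b != a -> e a b.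
  move=> aK bW ba; apply: contraFT ua => nab; apply/exists_inP; exists a => //.
  by apply/exists_inP; exists b => //; rewrite ba.
have [|s [/setDP[sW sK] simp]] := @simplicial_exists (W :\: K).
  by apply/set0Pn; exists z; rewrite inE zK.
exists s => //; split=> // x y xW yW sx sy xy.
have [xK|xK] := boolP (x \in K); first by apply: univ => //; rewrite eq_sym.
have [yK|yK] := boolP (y \in K); first by rewrite e_sym univ.
by apply: simp => //; apply/setDP.
Qed.

Lemma simplicial_conn W X s u v : simplicial W s -> u != s -> v != s ->
  conn e (W :\: X) u v -> conn e ((W :\ s) :\: X) u v.
Proof.
move=> [sW simp] us vs cuv.
(* While the walk sits at [s], the invariant keeps the vertex [b] before it; the next vertex equals
   [b] or is adjacent to it, [s] being simplicial. *)
pose P a := if a == s then exists b, [/\ b \in W :\: X, b != s, e s b &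
  conn e ((W :\ s) :\: X) u b] else is_true (conn e ((W :\ s) :\: X) u a).
have mem a : a \in W :\: X -> a != s -> a \in (W :\ s) :\: X.
  by rewrite !inE => /andP[-> ->] ->.
suff : P v by rewrite /P (negbTE vs).
move: v cuv {vs}; apply: conn_ind => [|a b aS bS ab]; rewrite /P.
  by rewrite (negbTE us); apply: connect0.
have [E|as_] := eqVneq a s; have [E'|bs] := eqVneq b s => //.
  case=> c [cS cs sc uc]; rewrite E in ab.
  have [<-//|cb] := eqVneq c b.
  apply: conn_trans uc _; apply: conn1; rewrite ?mem //.
  by apply: simp => //; [move: cS|move: bS]; rewrite !inE => /andP[].
- by move=> ua; exists a; split=> //; rewrite -E' e_sym.
by move=> ua; apply: conn_trans ua _; apply: conn1; rewrite ?mem.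
Qed.

Lemma simplicial_shrink_conn C s : {in C &, forall a b, conn e C a b} -> simplicial C s ->
  {in C :\ s &, forall a b, conn e (C :\ s) a b}.
Proof.
move=> cC simp a b /setD1P[as_ aC] /setD1P[bs bC].
by have := @simplicial_conn C set0 s a b simp as_ bs; rewrite !setD0; apply; apply: cC.
Qed.

Lemma simplicial_shrink_nbr C s z :
    {in C &, forall a b, conn e C a b} -> simplicial C s -> C != [set s] ->
    {in C, forall a, e s z -> e s a -> e a z} ->
    (exists2 c, c \in C & e z c) ->
  exists2 c, c \in C :\ s & e z c.
Proof.
move=> cC [sC simp] Cs sz [c cC' zc].
have [E|cs] := eqVneq c s; last by exists c => //; apply/setD1P.
have [t tC ts] : exists2 t, t \in C & t != s.
  apply/exists_inP; apply: contraR Cs => /exists_inPn H; apply/eqP/setP=> t.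
  by rewrite inE; apply/idP/eqP => [/H/negPn/eqP|->].
have : s != t -> exists2 c, c \in C :\ s & e s c.
  move: t {tC ts} (cC s t sC tC); apply: (@conn_ind V e C (fun t => s != t -> exists2 c, c \in C :\ s & e s c) s); first by rewrite eqxx.
  move=> a b aC bC ab IHa sb; have [E'|sa] := eqVneq s a; last exact: IHa.
  by exists b; [apply/setD1P; split=> //; rewrite eq_sym|rewrite E'].
case; first by rewrite eq_sym.
move=> d /setD1P[ds dC] sd; exists d; first exact/setD1P.
by rewrite e_sym; apply: sz => //; rewrite e_sym -E.
Qed.

(** A simplicial vertex of the whole configuration is neither [x] nor [y], since each of these has
    non-adjacent neighbours on the two sides. It is removed from its side, until that side is a
    single vertex adjacent to both [x] and [y] and simplicial. *)
Lemma clique_of_two_sides C C' x y :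
    {in C &, forall a b, conn e C a b} -> {in C' &, forall a b, conn e C' a b} ->
    [disjoint C & C'] -> {in C & C', forall a b, ~~ e a b} ->
    x \notin C :|: C' -> y \notin C :|: C' -> x != y ->
    (exists2 c, c \in C & e x c) -> (exists2 c, c \in C & e y c) ->
    (exists2 c, c \in C' & e x c) -> (exists2 c, c \in C' & e y c) ->
  e x y.
Proof.
have [n] := ubnP (#|C| + #|C'|); elim: n C C' => // n IH C C'; rewrite ltnS.
wlog: C C' / exists2 s, simplicial (C :|: C' :|: [set x; y]) s & s \in C.
  move=> H szC cC cC' dis sep xC yC xy xc yc xc' yc'.
  have [|s simp] := @simplicial_exists (C :|: C' :|: [set x; y]).
    by apply/set0Pn; exists x; rewrite !inE eqxx ?orbT.
  have no z : z \notin C :|: C' -> z \in [set x; y] -> (exists2 c, c \in C & e z c) ->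
      (exists2 c, c \in C' & e z c) -> s != z.
    move=> zC zxy [c cC1 zc] [c' cC1' zc']; apply/eqP=> E.
    case: (simp) => _ /(_ c c'); rewrite E !in_setU cC1 cC1' !orbT => /(_ isT isT zc zc').
    have -> : c != c'.
      by apply/eqP=> E'; move/pred0P: dis => /(_ c) /=; rewrite cC1 E' cC1'.
    by move/(_ isT); apply/negP; apply: sep.
  have := simp.1; rewrite !in_setU => /orP[/orP[sC|sC']|].
  - exact: (H C C' (ex_intro2 _ _ s simp sC)).
  - rewrite (setUC C) in xC yC simp.
    rewrite addnC in szC; rewrite disjoint_sym in dis.
    apply: (H C' C (ex_intro2 _ _ s simp sC')) => // a b aC bC.
    by rewrite e_sym; apply: sep.
  rewrite !inE => /orP[/eqP E|/eqP E].
    by have := no x xC (set21 _ _) xc xc'; rewrite E eqxx.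
  by have := no y yC (set22 _ _) yc yc'; rewrite E eqxx.
move=> [s simp sC] szC cC cC' dis sep xC yC xy xc yc xc' yc'.
have simpC : simplicial C s.
  by apply: simplicial_sub simp => //; apply: subset_trans (subsetUl _ _) (subsetUl _ _).
have [E|Cs] := eqVneq C [set s].
  case: simp => _; apply; rewrite ?inE ?eqxx ?orbT //.
    by case: xc => c; rewrite E inE => /eqP->; rewrite e_sym.
  by case: yc => c; rewrite E inE => /eqP->; rewrite e_sym.
have nin z : z \notin C :|: C' -> z \notin C by rewrite inE negb_or => /andP[].
have sh z : z \in [set x; y] -> z \notin C :|: C' -> {in C, forall a, e s z -> e s a -> e a z}.
  move=> zxy zC a aC sz sa; case: simp => _ /(_ a z).
  have -> : z \in C :|: C' :|: [set x; y] by rewrite inE zxy orbT.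
  rewrite !in_setU aC /=; apply=> //.
  by apply: contraNneq (nin _ zC) => <-.
apply: (IH (C :\ s) C') => //.
- by apply: leq_trans szC; rewrite [#|C|](cardsD1 s) sC.
- exact: simplicial_shrink_conn.
- by apply: disjointWl dis; rewrite subD1set.
- by move=> a b /setD1P[_ aC] bC; apply: sep.
- by apply: contra xC; apply/subsetP/setSU; rewrite subD1set.
- by apply: contra yC; apply/subsetP/setSU; rewrite subD1set.
- exact: (simplicial_shrink_nbr cC simpC Cs (sh x (set21 _ _) xC) xc).
- exact: (simplicial_shrink_nbr cC simpC Cs (sh y (set22 _ _) yC) yc).
Qed.

(** Simplicial vertices outside the clique [Q] are removed from [C] one by one; contact with each
    vertex of [Q] persists, and the last vertex left is adjacent to all of [Q]. *)
Lemma common_neighbour C Q :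
    {in C &, forall a b, conn e C a b} -> C != set0 -> cliqueb Q -> [disjoint C & Q] ->
    {in Q, forall x, exists2 c, c \in C & e x c} ->
  exists2 c, c \in C & {in Q, forall x, e x c}.
Proof.
have [n] := ubnP #|C|; elim: n C => // n IH C; rewrite ltnS => szC cC C0 cQ dis nbr.
have dCQ a : a \in C -> a \notin Q by move=> aC; rewrite (disjointFr dis).
have [|s simp sQ] := @simplicial_off_clique (C :|: Q) Q _ cQ.
  case/set0Pn: C0 => c cC1; apply/properP; split; first exact: subsetUr.
  by exists c; rewrite ?inE ?cC1 ?dCQ.
have sC : s \in C by have := simp.1; rewrite inE (negbTE sQ) orbF.
have simpC : simplicial C s by apply: simplicial_sub simp => //; apply: subsetUl.
have [E|Cs] := eqVneq C [set s].
  by exists s => // x /nbr[c]; rewrite E inE => /eqP->.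
have [|||||x xQ|c /setD1P[_ cC1] cnb] := IH (C :\ s); last by exists c.
- by apply: leq_trans szC; rewrite [#|C|](cardsD1 s) sC.
- exact: simplicial_shrink_conn.
- apply: contra Cs => /eqP E; apply/eqP/setP=> t; rewrite inE.
  by apply/idP/eqP=> [tC|->//]; apply: contraTeq isT => ts; move: (in_set0 t); rewrite -E in_setD1 ts tC.
- exact: cQ.
- by apply: disjointWl dis; rewrite subD1set.
apply: simplicial_shrink_nbr => //; last exact: nbr.
move=> a aC sx sa; case: simp => _ /(_ a x); rewrite !inE aC xQ orbT; apply=> //.
by apply: contraNneq (dCQ _ aC) => ->.
Qed.

End Chordal.

(** * Separators of size [d] in a [d]-connected chordal graph *)

Section Separators.
Variables (V : finType) (e : rel V) (d : nat).
Implicit Types (C Q S W X : {set V}).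
Hypotheses (e_sym : ssrbool.symmetric e) (ch : chordal_rel e).
Hypothesis dcon : forall X, #|X| < d -> {in ~: X &, forall u v, conn e (~: X) u v}.

Definition component Q u := [set a | conn e (~: Q) u a].

Definition dsep Q := (#|Q| == d) &&
  [exists u in ~: Q, [exists v in ~: Q, ~~ conn e (~: Q) u v]].

Lemma component_notin Q u a : u \notin Q -> a \in component Q u -> a \notin Q.
Proof. by rewrite !inE => uQ /conn_mem; rewrite !inE; apply. Qed.

Lemma component_conn Q u : u \notin Q -> {in component Q u &, forall a b, conn e (component Q u) a b}.
Proof.
move=> uQ.
have sub : component Q u \subset ~: Q by apply/subsetP=> a /(component_notin uQ); rewrite inE.
have ua a : a \in component Q u -> conn e (component Q u) u a.
  rewrite inE; move: a; apply: conn_ind => [|a b aQ bQ ab ua]; first exact: connect0.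
  have cua : conn e (~: Q) u a by apply: conn_sub ua.
  apply: conn_trans (ua) _; apply: conn1 => //; rewrite inE //.
  by apply: conn_trans cua _; apply: conn1.
move=> a b /ua ca /ua cb; apply: conn_trans cb; by rewrite conn_sym.
Qed.

Lemma dsepP Q : reflect (#|Q| = d /\ exists u v, [/\ u \notin Q, v \notin Q & ~~ conn e (~: Q) u v])
  (dsep Q).
Proof.
apply: (iffP andP) => [[/eqP-> /exists_inP[u uQ /exists_inP[v vQ uv]]]|[-> [u [v [uQ vQ uv]]]]].
  by split=> //; exists u, v; rewrite !inE in uQ vQ.
split=> //; apply/exists_inP; exists u; rewrite ?inE //.
by apply/exists_inP; exists v; rewrite ?inE.
Qed.

Lemma dsep_other Q u : dsep Q -> u \notin Q -> exists2 v, v \notin Q & ~~ conn e (~: Q) u v.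
Proof.
case/dsepP=> _ [v [w [vQ wQ vw]]] uQ.
case uv: (conn e (~: Q) u v); last by exists v; rewrite ?uv.
exists w => //; apply: contra vw; apply: conn_trans; by rewrite conn_sym.
Qed.

(** Otherwise the [d - 1] vertices of [Q :\ x] would already cut off the component of [u]. *)
Lemma component_full Q u x : dsep Q -> u \notin Q -> x \in Q -> exists2 c, c \in component Q u & e x c.
Proof.
move=> sQ uQ xQ; have [v vQ uv] := dsep_other sQ uQ; have [cQ _] := dsepP _ sQ.
apply/exists_inP; apply: contraNT uv => /exists_inPn nx.
have out z : z \notin Q -> z \in ~: (Q :\ x) by rewrite !inE => /negbTE->; rewrite andbF.
have lt : #|Q :\ x| < d by rewrite -cQ [#|Q|](cardsD1 x) xQ.
have cuv := dcon lt (out u uQ) (out v vQ); move: v cuv {vQ}.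
apply: (@conn_ind V e _ (fun v => conn e (~: Q) u v)) => [|a b aX bX ab ua].
  exact: connect0.
have ac : a \in component Q u by rewrite inE.
have [E|bx] := eqVneq b x; first by case/negP: (nx a ac); rewrite e_sym -E.
apply: conn_trans ua _; apply: conn1 => //; first by rewrite inE (component_notin uQ ac).
by move: bX; rewrite !inE bx.
Qed.

Lemma dsep_clique Q : dsep Q -> cliqueb e Q.
Proof.
move=> sQ; apply/cliqueP=> x y xQ yQ xy.
have [_ [u [v [uQ vQ uv]]]] := dsepP _ sQ.
have nC : {in Q, forall z, z \notin component Q u :|: component Q v}.
  move=> z zQ; rewrite inE; apply/norP; split.
    by apply/negP => /(component_notin uQ); rewrite zQ.
  by apply/negP => /(component_notin vQ); rewrite zQ.
apply: (clique_of_two_sides e_sym ch (C := component Q u) (C' := component Q v)) => //;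
  try exact: component_conn; try exact: nC; try exact: component_full.
- rewrite disjoint_subset; apply/subsetP=> a; rewrite !inE => ua; apply: contra uv => va.
  by apply: conn_trans ua _; rewrite conn_sym.
- move=> a b aC bC; apply: contra uv => ab; move: (aC) (bC); rewrite !inE => ua vb.
  apply: conn_trans ua _; apply: (@conn_trans _ _ _ b); last by rewrite conn_sym.
  by apply: conn1; rewrite ?inE ?(component_notin uQ aC) ?(component_notin vQ bC).
Qed.

(** On each of its sides a separator thus extends to a clique with [d + 1] vertices; these provide
    its neighbours in the tree. *)
Lemma dsep_apex Q u : dsep Q -> u \notin Q ->
  exists2 c, c \in component Q u & {in Q, forall x, e x c}.
Proof.
move=> sQ uQ; apply: (common_neighbour e_sym ch).
- exact: component_conn.
- by apply/set0Pn; exists u; rewrite inE; exact: connect0.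
- exact: dsep_clique.
- rewrite disjoint_subset; apply/subsetP=> a; exact: component_notin.
- by move=> x xQ; apply: component_full.
Qed.

End Separators.

(** * The tree of maximal cliques and d-separators *)

Section SeparatorTree.
Variables (V : finType) (d : nat) (E Gs : {set {set V}}).
Implicit Types (Q S X : {set V}) (P : seq (tnode V)) (x y : tnode V).

(** For distinct vertices this is adjacency in the totally loose closure: [gE] assumes it here,
    [tlc_adj] proves it. *)
Definition glued (a b : V) := [forall Q : {set V},
  (#|Q| == d) ==> (a \notin Q) ==> (b \notin Q) ==> conn (adj E) (~: Q) a b].

Hypotheses (e_sym : ssrbool.symmetric (adj E)) (e_irr : ssrbool.irreflexive (adj E)).
Hypotheses (ch : chordal_rel (adj E)).
Hypothesis dcon : forall X, #|X| < d -> {in ~: X &, forall u v, conn (adj E) (~: X) u v}.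
Hypothesis gE : forall a b, adj Gs a b = (a != b) && glued a b.

Local Notation cn Q := (conn (adj E) (~: Q)).
Local Notation dsep := (dsep (adj E) d).
Local Notation mclique := (max_clique Gs).

Lemma cn_sym Q : ssrbool.symmetric (cn Q).
Proof. exact: conn_sym. Qed.

Lemma gluedP a b : reflect (forall Q, #|Q| = d -> a \notin Q -> b \notin Q -> cn Q a b) (glued a b).
Proof.
apply: (iffP forallP) => H Q.
  by move=> cQ aQ bQ; have := H Q; rewrite cQ eqxx aQ bQ.
by apply/implyP=> /eqP cQ; apply/implyP=> aQ; apply/implyP=> bQ; apply: H.
Qed.

Lemma adjE_Gs a b : adj E a b -> adj Gs a b.
Proof.
move=> ab; rewrite gE; apply/andP; split; first by apply: contraTneq ab => ->; rewrite e_irr.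
by apply/gluedP=> Q _ aQ bQ; apply: conn1; rewrite ?inE.
Qed.

Lemma Gs_sym : ssrbool.symmetric (adj Gs).
Proof. by move=> a b; rewrite /adj setUC. Qed.

Lemma clique_conn Q S a b : #|Q| = d -> clique Gs S -> a \in S -> b \in S ->
  a \notin Q -> b \notin Q -> cn Q a b.
Proof.
move=> cQ /cliqueP cS aS bS aQ bQ; have [->|ab] := eqVneq a b; first exact: connect0.
by have := cS a b aS bS ab; rewrite gE => /andP[_ /gluedP]; apply.
Qed.

Lemma dsep_card Q : dsep Q -> #|Q| = d.
Proof. by case/dsepP. Qed.

Lemma dsep_cliqueGs Q : dsep Q -> clique Gs Q.
Proof.
move=> sQ; apply/cliqueP=> a b aQ bQ ab; apply: adjE_Gs.
by have /cliqueP := dsep_clique e_sym ch dcon sQ; apply.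
Qed.

Lemma clique_ext S : clique Gs S -> exists2 S', mclique S' & S \subset S'.
Proof. by move=> cS; have [S' mS' sub] := maxset_exists cS; exists S'. Qed.

Lemma mclique_clique S : mclique S -> clique Gs S.
Proof. by case/maxsetP. Qed.

(** Extending [Q] and its apex [c] on the side of [u] to a maximal clique gives the node [Q] a tree
    neighbour towards every component. *)
Lemma dsep_side Q u : dsep Q -> u \notin Q ->
  exists S c, [/\ mclique S, Q \subset S, c \in S, c \notin Q & cn Q u c].
Proof.
move=> sQ uQ; have [c cu cQ] := dsep_apex e_sym ch dcon sQ uQ.
have [|S mS sub] := @clique_ext (c |: Q).
  apply/cliqueP=> a b; rewrite !in_setU1 => /predU1P[->|aQ] /predU1P[->|bQ]; rewrite ?eqxx // => ab.
  - by rewrite Gs_sym; apply/adjE_Gs/cQ.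
  - exact/adjE_Gs/cQ.
  by have /cliqueP := dsep_cliqueGs sQ; apply.
exists S, c; split=> //.
- exact: subset_trans (subsetUr _ _) sub.
- by apply: (subsetP sub); rewrite setU11.
- exact: component_notin cu.
by move: cu; rewrite inE.
Qed.

Lemma mclique_out Q S : dsep Q -> mclique S -> exists2 a, a \in S & a \notin Q.
Proof.
move=> sQ mS; apply/exists_inP; apply: contraT => /exists_inPn H.
have SQ : S \subset Q by apply/subsetP=> a /H; rewrite negbK.
have [_ [u [v [uQ _ _]]]] := dsepP _ _ _ sQ.
have [S' [c [mS' QS' cS' cQ _]]] := dsep_side sQ uQ.
case/maxsetP: mS => _ /(_ S' (mclique_clique mS') (subset_trans SQ QS')) ES.
by case/negP: cQ; apply: (subsetP SQ); rewrite -ES.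
Qed.

Definition sepS Q S S' :=
  [exists a in S :\: Q, [exists b in S' :\: Q, ~~ cn Q a b]].

Lemma sepSP Q S S' : reflect (exists a b, [/\ a \in S, a \notin Q, b \in S', b \notin Q & ~~ cn Q a b])
  (sepS Q S S').
Proof.
apply: (iffP exists_inP) => [[a /setDP[aS aQ] /exists_inP[b /setDP[bS bQ] ab]]|].
  by exists a, b.
move=> [a [b [aS aQ bS bQ ab]]]; exists a; first by rewrite inE aS aQ.
by apply/exists_inP; exists b => //; rewrite inE bS bQ.
Qed.

Lemma sepS_sym Q S S' : sepS Q S S' = sepS Q S' S.
Proof.
by apply/sepSP/sepSP => [] [a [b [? ? ? ? ab]]]; exists b, a; rewrite cn_sym.
Qed.

(** Off [Q], a clique of the closure lies in one component, so a single separated pair forces all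
    pairs to be separated. *)
Lemma sepS_all Q S S' a b : #|Q| = d -> clique Gs S -> clique Gs S' -> sepS Q S S' ->
  a \in S -> a \notin Q -> b \in S' -> b \notin Q -> ~~ cn Q a b.
Proof.
move=> cQ cS cS' /sepSP[a' [b' [aS' aQ' bS' bQ' ab']]] aS aQ bS bQ; apply: contra ab' => ab.
apply: (@conn_trans _ _ _ a); first exact: (clique_conn cQ cS).
by apply: conn_trans ab _; apply: (clique_conn cQ cS').
Qed.

Lemma component_off Q Q' u a (x : V) : dsep Q -> u \notin Q ->
    (forall z, cn Q u z -> z \notin Q') -> cn Q u a -> x \in Q -> x \notin Q' ->
  cn Q' a x.
Proof.
move=> sQ uQ off ua xQ xQ'.
have [c cu xc] := component_full e_sym dcon sQ uQ xQ.
have cQ' : c \notin Q' by apply: off; move: cu; rewrite inE.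
apply: (@conn_trans _ _ _ c); last by apply: conn1; rewrite ?inE // e_sym.
have aC : a \in component (adj E) Q u by rewrite inE.
apply: conn_sub (component_conn e_sym uQ aC cu) => //.
by apply/subsetP=> z; rewrite !inE => /off.
Qed.

(** Such a [Q'] meets the side of [u], hence as a clique it misses the side of [v]. So [v] stays
    joined to a vertex [x] of [Q] in [S1], from which [Q'] separates [S]. *)
Lemma sepS_shrink Q Q' S S' S1 u v c : dsep Q -> clique Gs S -> clique Gs S' -> clique Gs S1 ->
    u \in S -> u \notin Q -> v \in S' -> v \notin Q -> ~~ cn Q u v ->
    Q \subset S1 -> c \in S1 -> c \notin Q -> cn Q u c ->
    dsep Q' -> sepS Q' S S1 ->
  sepS Q' S S' && (Q' != Q).
Proof.
move=> sQ cS cS' cS1 uS uQ vS' vQ uv QS1 cS1' cQ uc sQ' sep.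
have [dQ dQ'] := (dsep_card sQ, dsep_card sQ').
have Q'Q : Q' != Q.
  by apply: contraL uc => /eqP E'; rewrite E' in sep; apply: (sepS_all dQ cS cS1 sep).
have [x xQ xQ'] : exists2 x, x \in Q & x \notin Q'.
  apply/subsetPn; apply: contra Q'Q => sub.
  by rewrite eq_sym eqEcard sub dQ dQ' leqnn.
case/sepSP: (sep) => a [b [aS aQ' _ _ _]].
have ax : ~~ cn Q' a x by apply: (sepS_all dQ' cS cS1 sep) => //; apply: (subsetP QS1).
(* Otherwise [a], which lies in [Q] or on the side of [u], would reach [x] without meeting [Q']. *)
have [y uy yQ'] : exists2 y, cn Q u y & y \in Q'.
  apply/exists_inP; apply: contraT => /exists_inPn off; case/negP: ax.
  have [aQ|aQ] := boolP (a \in Q); first exact: (clique_conn dQ' (dsep_cliqueGs sQ)).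
  apply: (component_off sQ uQ) => //; exact: (clique_conn dQ cS).
have yQ : y \notin Q by apply: (component_notin (e := adj E) uQ); rewrite inE.
have offv z : cn Q v z -> z \notin Q'.
  move=> vz; apply: contra uv => zQ'; apply: conn_trans uy _.
  apply: (@conn_trans _ _ _ z); last by rewrite cn_sym.
  apply: (clique_conn dQ (dsep_cliqueGs sQ')) => //.
  by apply: (component_notin (e := adj E) vQ); rewrite inE.
have vQ' : v \notin Q' by apply: offv; apply: connect0.
rewrite Q'Q andbT; apply/sepSP; exists a, v; split=> //.
by apply: contra ax => av; apply: conn_trans av _; apply: (component_off sQ vQ) => //; apply: connect0.
Qed.

(** The induction measure of [mclique_reach], in place of the distance of two cliques in the
    tree. *)
Definition nsep S S' := #|[set Q : {set V} | dsep Q && sepS Q S S']|.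

Lemma nsep_shrink Q S S' S1 u v c : dsep Q -> clique Gs S -> clique Gs S' -> clique Gs S1 ->
    u \in S -> u \notin Q -> v \in S' -> v \notin Q -> ~~ cn Q u v ->
    Q \subset S1 -> c \in S1 -> c \notin Q -> cn Q u c ->
  nsep S S1 < nsep S S'.
Proof.
move=> sQ cS cS' cS1 uS uQ vS' vQ uv QS1 cS1' cQ uc.
have sh Q' := @sepS_shrink Q Q' S S' S1 u v c sQ cS cS' cS1 uS uQ vS' vQ uv QS1 cS1' cQ uc.
apply: proper_card; apply/properP; split.
  by apply/subsetP=> Q'; rewrite !inE => /andP[sQ' /(sh Q' sQ')/andP[-> _]]; rewrite sQ'.
exists Q; rewrite !inE sQ /=; first by apply/sepSP; exists u, v.
by apply/negP => /(sh Q sQ)/andP[_]; rewrite eqxx.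
Qed.

Lemma Gs_nonadj_sep u v : u != v -> ~~ adj Gs u v ->
  exists Q, [/\ dsep Q, u \notin Q, v \notin Q & ~~ cn Q u v].
Proof.
move=> uv; rewrite gE uv /= => /forallPn[Q]; rewrite !negb_imply => /and4P[cQ uQ vQ nuv].
by exists Q; split=> //; apply/dsepP; split; [apply/eqP|exists u, v].
Qed.

(** The closure adds only pairs that no [d] vertices separate, so deleting [d] vertices leaves the
    same components in [E] and in [Gs]. *)
Lemma separatorP Q : separator d Gs Q <-> dsep Q.
Proof.
split=> [[cQ nc]|sQ].
  apply: contraT => nsQ; case: nc => u v uQ vQ; apply/reach_conn.
  have [->|uv] := eqVneq u v; first exact: connect0.
  have : cn Q u v.
    by apply: contraNT nsQ => ncn; apply/dsepP; split=> //; exists u, v; rewrite !inE in uQ vQ.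
  by apply: conn_sub => // a b _ _; apply: adjE_Gs.
have [cQ [u [v [uQ vQ uv]]]] := dsepP _ _ _ sQ; split=> // H.
have [uQ' vQ'] : u \in ~: Q /\ v \in ~: Q by rewrite !inE.
have /reach_conn c := H u v uQ' vQ'; case/negP: uv; move: v c {vQ vQ'}.
apply: conn_ind => [|a b aQ bQ ab ua]; first exact: connect0.
rewrite !inE in aQ bQ; apply: conn_trans ua _.
by move: ab; rewrite gE => /andP[_ /gluedP]; apply.
Qed.

Definition via (A : {set V} -> Prop) x := is_tnode d Gs x /\ (x.1 = false -> A x.2).

Lemma tadj_sym x y : tadj d Gs x y -> tadj d Gs y x.
Proof. by case=> nx ny H; split=> //; move: H; case: (x.1); case: (y.1); rewrite /= ?orbF. Qed.

Lemma reach_sym (T : Type) (r : T -> T -> Prop) (N : T -> Prop) a b :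
  (forall a b, r a b -> r b a) -> reach_in r N a b -> reach_in r N b a.
Proof.
move=> rs; elim=> [c c' [Nc [Nc' cc']]|c|c c' c'' _ H _ H'].
- by apply: Relation_Operators.rt_step; split=> //; split=> //; apply: rs.
- exact: Relation_Operators.rt_refl.
exact: Relation_Operators.rt_trans H' H.
Qed.

(** By maximality, distinct [S] and [S'] contain non-adjacent [u] and [v], separated by some [Q].
    The walk goes from [S] to a clique [S1] around [Q] on the side of [u], through [Q] to [S1'] on
    the side of [v], and on to [S']. By [nsep_shrink] the outer legs have fewer separators. *)
Lemma mclique_reach (A : {set V} -> Prop) S S' : mclique S -> mclique S' ->
    (forall Q, dsep Q -> sepS Q S S' -> A Q) ->
  reach_in (tadj d Gs) (via A) (true, S) (true, S').
Proof.
have [n] := ubnP (nsep S S'); elim: n S S' => // n IH S S'; rewrite ltnS => szn mS mS' HA.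
have [->|SS'] := eqVneq S S'; first exact: Relation_Operators.rt_refl.
have [cS cS'] := (mclique_clique mS, mclique_clique mS').
have [u [v [uS vS' uv nuv]]] : exists u v, [/\ u \in S, v \in S', u != v & ~~ adj Gs u v].
  apply: NNPP => no; case/eqP: SS'.
  have adjc u v : u \in S -> v \in S' -> u != v -> adj Gs u v.
    by move=> uS vS' uv; apply: contraT => nuv; case: no; exists u, v.
  have cU : clique Gs (S :|: S').
    apply/cliqueP=> a b; rewrite !in_setU => /orP[aS|aS'] /orP[bS|bS'] ab.
    - by move/cliqueP: cS; apply.
    - exact: adjc.
    - by rewrite Gs_sym; apply: adjc; rewrite // eq_sym.
    - by move/cliqueP: cS'; apply.
  case/maxsetP: (mS) => _ /(_ _ cU (subsetUl _ _)) E1.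
  by case/maxsetP: (mS') => _ /(_ _ cU (subsetUr _ _)) E2; rewrite -[LHS]E1 E2.
have [Q [sQ uQ vQ ncn]] := Gs_nonadj_sep uv nuv.
have nvu : ~~ cn Q v u by rewrite cn_sym.
have [S1 [c [mS1 QS1 cS1 cQ uc]]] := dsep_side sQ uQ.
have [S1' [c' [mS1' QS1' cS1' cQ' vc]]] := dsep_side sQ vQ.
have [k1 k1'] := (mclique_clique mS1, mclique_clique mS1').
have sepQ : sepS Q S S' by apply/sepSP; exists u, v.
have NQ : via A (false, Q) by split=> [|_]; [apply/separatorP|apply: HA].
have Nm T : mclique T -> via A (true, T) by split.
have step x y : via A x -> via A y -> tadj d Gs x y -> reach_in (tadj d Gs) (via A) x y.
  by move=> Nx Ny xy; apply: Relation_Operators.rt_step.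
apply: (@Relation_Operators.rt_trans _ _ _ (true, S1)).
  apply: IH => // [|Q' sQ' sep].
    by apply: leq_trans szn; apply: (@nsep_shrink Q S S' S1 u v c).
  have /andP[sep' _] := sepS_shrink sQ cS cS' k1 uS uQ vS' vQ ncn QS1 cS1 cQ uc sQ' sep.
  exact: HA.
apply: (@Relation_Operators.rt_trans _ _ _ (false, Q)).
  by apply: step => //; split=> //=; [apply/separatorP|rewrite QS1].
apply: (@Relation_Operators.rt_trans _ _ _ (true, S1')).
  by apply: step => //; split=> //=; apply/separatorP.
apply: reach_sym; first exact: tadj_sym.
apply: IH => // [|Q' sQ' sep].
  apply: leq_trans szn; have -> : nsep S S' = nsep S' S.
    by apply: eq_card => Q'; rewrite !inE sepS_sym.
  exact: (@nsep_shrink Q S' S S1' v u c').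
have /andP[sep' _] := sepS_shrink sQ cS' cS k1' vS' vQ uS uQ nvu QS1' cS1' cQ' vc sQ' sep.
by apply: HA => //; rewrite sepS_sym.
Qed.

Local Notation nd := (true, set0).

Lemma mclique_path_exists u v : exists P, [/\ tpath d Gs P, covers P u & covers P v].
Proof.
have cl w : clique Gs [set w] by apply/cliqueP=> a b /set1P-> /set1P->; rewrite eqxx.
have [S mS uS] := clique_ext (cl u); have [S' mS' vS'] := clique_ext (cl v).
rewrite !sub1set in uS vS'.
have := @mclique_reach (fun _ => True) S S' mS mS' (fun _ _ _ => I).
(* A boolean copy of [tadj], which makes [connect] and the shortening of paths available. *)
pose tb (x y : bool * {set V}) : bool := excluded_middle_informative (tadj d Gs x y).
have tbP x y : tb x y -> tadj d Gs x y by rewrite /tb; case: excluded_middle_informative.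
move=> r; have : connect tb (true, S) (true, S').
  elim: r => [x y [_ [_ xy]]|x|x y z _ xy _]; [|exact: connect0|exact: connect_trans].
  by apply: connect1; rewrite /tb; case: excluded_middle_informative.
case/connectP=> p0 /shortenP[p pth un _] lst.
exists ((true, S) :: p); split; last 1 first.
- by exists (true, S'); rewrite // lst mem_last.
- split=> // [x|i]; rewrite ?inE.
    case/predU1P=> [->//|xp]; have [i isz <-] := nthP nd xp.
    by have /(pathP nd)/(_ i isz)/tbP[] := pth.
  by move=> isz; have /(pathP nd)/(_ i isz)/tbP := pth.
by exists (true, S); rewrite ?inE ?eqxx.
Qed.

Lemma min_cover_path_exists u v : exists P, min_cover_path d Gs u v P.
Proof.
have [P [tP Pu Pv]] := mclique_path_exists u v.
have [n] := ubnP (size P); elim: n P tP Pu Pv => // n IH P tP Pu Pv; rewrite ltnS => szP.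
have [[P' [tP' Pu' Pv' sub nsub]]|no] := classic (exists P', [/\ tpath d Gs P',
    covers P' u, covers P' v, {subset P' <= P} & ~ {subset P <= P'}]); last first.
  exists P; split=> // P' tP' Pu' Pv' sub; apply: NNPP => nsub.
  by apply: no; exists P'.
have [_ un' _ _] := tP'.
apply: IH tP' Pu' Pv' _; apply: leq_trans szP; rewrite ltnNge; apply/negP => le.
have [_ E'] := uniq_min_size un' sub le.
by apply: nsub => x; rewrite E'.
Qed.

(** The stretch between positions [i] and [j] is itself a path covering [u] and [v], so by
    minimality it is all of [P]. *)
Lemma min_cover_path_segment P u v i j : min_cover_path d Gs u v P -> i <= j < size P ->
    (u \in (nth nd P i).2 /\ v \in (nth nd P j).2) \/
    (v \in (nth nd P i).2 /\ u \in (nth nd P j).2) ->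
  nth nd P i = head nd P /\ nth nd P j = last nd P.
Proof.
case=> [[_ un nP aP] _ _ mn] /andP[ij jsz] uv.
pose P' := take (j - i).+1 (drop i P).
have szP' : size P' = (j - i).+1.
  by rewrite size_takel // size_drop -subSn // leq_sub2r.
have nthP' k : k < size P' -> nth nd P' k = nth nd P (i + k).
  by rewrite szP' => lt; rewrite nth_take // nth_drop.
have subP : {subset P' <= P} by move=> x /mem_take/mem_drop.
have inP' k : i <= k <= j -> nth nd P k \in P'.
  move=> /andP[ik kj]; have lt : k - i < size P' by rewrite szP' ltnS leq_sub2r.
  by rewrite -(subnKC ik) -nthP' // mem_nth.
have mi : nth nd P i \in P' by apply: inP'; rewrite leqnn.
have mj : nth nd P j \in P' by apply: inP'; rewrite ij leqnn.
have tP' : tpath d Gs P'.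
  split=> [||x /subP/nP//|k lt]; first by rewrite -size_eq0 szP'.
    by rewrite take_uniq // drop_uniq.
  rewrite !nthP' // ?(ltnW lt) // addnS; apply: aP.
  apply: leq_ltn_trans jsz; rewrite szP' ltnS in lt.
  by rewrite -addnS -leq_subRL // addnC.
have cv w : w \in (nth nd P i).2 \/ w \in (nth nd P j).2 -> covers P' w.
  by case=> ww; [exists (nth nd P i)|exists (nth nd P j)].
have /uniq_leq_size - /(_ un) : {subset P <= P'}.
  by apply: mn tP' _ _ subP; apply: cv; case: uv => -[]; auto.
rewrite szP' => le.
have ends n : n <= (j - i).+1 -> j < n -> i = 0 /\ j = n.-1 by lia.
have [i0 jl] := ends _ le jsz.
by rewrite {1}i0 nth0 jl nth_last.
Qed.

Lemma min_cover_path_ends P u v : min_cover_path d Gs u v P ->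
  (u \in (head nd P).2 /\ v \in (last nd P).2) \/ (v \in (head nd P).2 /\ u \in (last nd P).2).
Proof.
move=> mP; case: (mP) => _ [x xP ux] [y yP vy] _.
have [i isz Ei] := nthP nd xP; have [j jsz Ej] := nthP nd yP.
rewrite -Ei in ux; rewrite -Ej in vy.
have [ij|ji] := leqP i j.
  by have [|| <- <-] := @min_cover_path_segment P u v i j mP; rewrite ?ij //; left.
by have [|| <- <-] := @min_cover_path_segment P u v j i mP; rewrite ?(ltnW ji) //; right.
Qed.

Lemma node_clique x : is_tnode d Gs x -> clique Gs x.2.
Proof.
case: x => [[] S]; first exact: mclique_clique.
by move/separatorP/dsep_cliqueGs.
Qed.

Lemma node_out X x : dsep X -> is_tnode d Gs x -> x <> (false, X) ->
  exists2 a, a \in x.2 & a \notin X.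
Proof.
case: x => [[] S] sX; first by move=> mS _; apply: mclique_out.
move=> /separatorP sS ne; apply/subsetPn; apply: contra_notN ne => /= sub.
by congr pair; apply/eqP; rewrite eqEcard sub (dsep_card sS) (dsep_card sX) leqnn.
Qed.

Lemma reach_ind (T : Type) (r : T -> T -> Prop) (N P : T -> Prop) a b :
  (forall a b, N a -> N b -> r a b -> P a -> P b) -> reach_in r N a b -> P a -> P b.
Proof. by move=> st; elim=> [c c' [Nc [Nc' cc']]|//|c c' c'' _ H _ H' /H]; [exact: st|]. Qed.

(** * Cut vertices of the tree with added edges *)

Section Augmented.
Variable E' : {set {set V}}.
Local Notation F := (add_edges E E').

Lemma adj_add a b : adj F a b = adj E a b || ([set a; b] \in E').
Proof. by rewrite /adj /add_edges in_setU. Qed.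

Lemma conn_add X a b : cn X a b -> conn (adj F) (~: X) a b.
Proof. by apply: conn_sub => // x y _ _; rewrite adj_add => ->. Qed.

Lemma connected_of_no_cut X : dsep X ->
    ~ cut_vertex (is_tnode d Gs) (madj d Gs E') (false, X) ->
  {in ~: X &, forall u v, conn (adj F) (~: X) u v}.
Proof.
move=> sX ncut u v uX vX; apply: contraT => nuv; case: ncut.
rewrite !in_setC in uX vX; have dX := dsep_card sX.
split; first exact/separatorP.
have cl w : clique Gs [set w] by apply/cliqueP=> a b /set1P-> /set1P->; rewrite eqxx.
have [S mS uS] := clique_ext (cl u); have [S' mS' vS'] := clique_ext (cl v).
rewrite !sub1set in uS vS'.
exists (true, S), (true, S'); split=> //.
  apply: (@reach_ind _ _ _ (fun z => reach_in (madj d Gs E') (is_tnode d Gs) (true, S) z) _ _ _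
    (@mclique_reach (fun _ => True) S S' mS mS' (fun _ _ _ => I)));
    last exact: Relation_Operators.rt_refl.
  move=> a b [Na _] [Nb _] ab Sa; apply: Relation_Operators.rt_trans Sa _.
  by apply: Relation_Operators.rt_step; split=> //; split=> //; left.
(* The invariant along tree walks avoiding [X]: the part of a node off [X] is joined to [u]. One
   joined vertex suffices, since nodes are cliques. *)
pose J x := forall a, a \in x.2 -> a \notin X -> conn (adj F) (~: X) u a.
have Jc x b : is_tnode d Gs x -> b \in x.2 -> b \notin X -> conn (adj F) (~: X) u b -> J x.
  move=> Nx bx bX ub a ax aX; apply: conn_trans ub _; apply: conn_add.
  exact: clique_conn (node_clique Nx) _ _ _ _.
have Jt x y : x <> (false, X) -> y <> (false, X) -> tadj d Gs x y -> J x -> J y.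
  move=> xX yX [Nx Ny xy] Jx.
  have [a ax [ay aX]] : exists2 a, a \in x.2 & a \in y.2 /\ a \notin X.
    case/orP: xy => /andP[_ /subsetP sub].
      by have [a ay aX] := node_out sX Ny yX; exists a; auto.
    by have [a ax aX] := node_out sX Nx xX; exists a; auto.
  exact: (Jc y a) (Jx a ax aX).
(* For an added edge there are two cases. If [X] is inside the path, then [a] and [b] are off [X]
   and the edge [ab] itself links the end nodes; otherwise [J] is passed along the path. *)
have Je P a b : min_cover_path d Gs a b P -> [set a; b] \in E' ->
    head nd P <> (false, X) -> last nd P <> (false, X) ->
    (J (head nd P) -> J (last nd P)) /\ (J (last nd P) -> J (head nd P)).
  move=> mP ab hX lX; case: (mP) => [[P0 un nP aP] [x xP ax] [y yP by_] _].
  have szP : 0 < size P by rewrite lt0n size_eq0.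
  have hP : head nd P \in P by rewrite -nth0 mem_nth.
  have lP : last nd P \in P by rewrite -nth_last mem_nth // prednK.
  have [XP|XP] := boolP ((false, X) \in P).
    have [k ksz Ek] := nthP nd XP.
    (* Were [a] in [X], the stretch from [X] to a node containing [b] would cover both vertices, and
       [X] would be an end of the path. *)
    have aX : a \notin X.
      apply/negP=> aX; have [j jsz Ej] := nthP nd yP.
      have [kj|jk] := leqP k j.
        have [||E1 _] := @min_cover_path_segment P a b k j mP; rewrite ?kj //.
          by left; rewrite Ek Ej.
        by case: hX; rewrite -E1.
      have [||_ E1] := @min_cover_path_segment P a b j k mP; rewrite ?(ltnW jk) //.
        by right; rewrite Ek Ej.
      by case: lX; rewrite -E1.
    have bX : b \notin X.
      apply/negP=> bX; have [j jsz Ej] := nthP nd xP.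
      have [kj|jk] := leqP k j.
        have [||E1 _] := @min_cover_path_segment P a b k j mP; rewrite ?kj //.
          by right; rewrite Ek Ej.
        by case: hX; rewrite -E1.
      have [||_ E1] := @min_cover_path_segment P a b j k mP; rewrite ?(ltnW jk) //.
        by left; rewrite Ek Ej.
      by case: lX; rewrite -E1.
    have cab : conn (adj F) (~: X) a b by apply: conn1; rewrite ?inE // adj_add ab orbT.
    have cba : conn (adj F) (~: X) b a by apply: conn1; rewrite ?inE // adj_add setUC ab orbT.
    case: (min_cover_path_ends mP) => -[h l]; split=> HJ.
    - by apply: (Jc _ b (nP _ lP) l bX); apply: conn_trans cab; apply: HJ.
    - by apply: (Jc _ a (nP _ hP) h aX); apply: conn_trans cba; apply: HJ.
    - by apply: (Jc _ a (nP _ lP) l aX); apply: conn_trans cba; apply: HJ.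
    - by apply: (Jc _ b (nP _ hP) h bX); apply: conn_trans cab; apply: HJ.
  have all i : i < size P -> (J (head nd P) -> J (nth nd P i)) /\ (J (nth nd P i) -> J (head nd P)).
    elim: i => [|i IH] lt; first by rewrite nth0.
    have [H1 H2] := IH (ltnW lt); have t := aP i lt.
    have n1 : nth nd P i <> (false, X) by move=> Ei; case/negP: XP; rewrite -Ei mem_nth // ltnW.
    have n2 : nth nd P i.+1 <> (false, X) by move=> Ei; case/negP: XP; rewrite -Ei mem_nth.
    split=> HJ; first exact: Jt n1 n2 t (H1 HJ).
    exact/H2/(Jt _ _ n2 n1 (tadj_sym t)).
  by rewrite -nth_last; apply: all; rewrite prednK.
move=> r; have : J (true, S').
  apply: (@reach_ind _ _ _ J _ _ _ r); last by apply: (Jc _ u) => //; apply: connect0.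
  move=> x y [Nx xX] [Ny yX] [t|[a [b [ab [[P [mP hP lP]]|[P [mP hP lP]]]]]]].
  - exact: Jt.
  - by rewrite -hP -lP; apply: (proj1 (Je P a b mP ab _ _)); rewrite ?hP ?lP.
  - by rewrite -hP -lP; apply: (proj2 (Je P a b mP ab _ _)); rewrite ?hP ?lP.
by move=> /(_ v vS' vX); apply/negP.
Qed.

(** A walk in the graph minus [X] lifts to the tree: at each vertex [c] of it, all maximal cliques
    containing [c] are reachable from [x] without using the node [X]. *)
Lemma no_cut_of_connected X : dsep X ->
    {in ~: X &, forall u v, conn (adj F) (~: X) u v} ->
  ~ cut_vertex (is_tnode d Gs) (madj d Gs E') (false, X).
Proof.
move=> sX cX [_ [x [y [[Nx Ny] xX yX _ nreach]]]]; apply: nreach.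
set N := fun a => _; have dX := dsep_card sX.
have step a b : N a -> N b -> madj d Gs E' a b -> reach_in (madj d Gs E') N a b.
  by move=> Na Nb ab; apply: Relation_Operators.rt_step.
have rsym a b : reach_in (madj d Gs E') N a b -> reach_in (madj d Gs E') N b a.
  apply: (@reach_sym _ _ N a b) => {}a {}b [ab|[u [v [uv t]]]]; first by left; apply: tadj_sym.
  by right; exists u, v; split=> //; case: t; auto.
have Nm S : mclique S -> N (true, S) by [].
have attach a c : N a -> c \in a.2 ->
    exists S, [/\ mclique S, c \in S & reach_in (madj d Gs E') N a (true, S)].
  case: a => [[] Q] [Na aX] cQ; first by exists Q; split=> //; apply: Relation_Operators.rt_refl.
  have /separatorP sQ := Na; have [_ [u [_ [uQ _ _]]]] := dsepP _ _ _ sQ.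
  have [S [_ [mS QS _ _ _]]] := dsep_side sQ uQ.
  exists S; split=> //; first exact: (subsetP QS).
  by apply: step => //; left; split=> //=; rewrite QS.
(* [X] cannot separate two cliques sharing a vertex off [X], so the walk of [mclique_reach] avoids
   it. *)
have same S S' c : mclique S -> mclique S' -> c \in S -> c \in S' -> c \notin X ->
    reach_in (madj d Gs E') N (true, S) (true, S').
  move=> mS mS' cS cS' ncX.
  have HA Q : dsep Q -> sepS Q S S' -> Q <> X.
    move=> _ sep EQ; rewrite EQ in sep.
    have := sepS_all dX (mclique_clique mS) (mclique_clique mS') sep cS ncX cS' ncX.
    by rewrite [cn X c c]connect0.
  apply: (@reach_ind _ _ _ (fun z => reach_in (madj d Gs E') N (true, S) z) _ _ _
    (mclique_reach mS mS' HA)); last exact: Relation_Operators.rt_refl.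
  move=> a b [Na aX] [Nb bX] ab Sa; apply: Relation_Operators.rt_trans Sa _.
  apply: step; [|..|by left]; split=> // Ea; first by case: aX; rewrite Ea.
  by case: bX; rewrite Ea.
have [a ax aX] := node_out sX Nx xX; have [b yb bX] := node_out sX Ny yX.
have [S [mS aS rS]] := attach x a (conj Nx xX) ax.
have [S' [mS' bS' rS']] := attach y b (conj Ny yX) yb.
suff H : forall c, conn (adj F) (~: X) a c ->
    forall T, mclique T -> c \in T -> reach_in (madj d Gs E') N x (true, T).
  apply: Relation_Operators.rt_trans (rsym _ _ rS').
  by apply: (H b) => //; apply: cX; rewrite inE.
apply: conn_ind => [T mT aT|c c' cX1 cX2 cc' Hc T mT cT].
  apply: Relation_Operators.rt_trans rS _; exact: same aS aT aX.
rewrite !inE in cX1 cX2.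
move: cc'; rewrite adj_add => /orP[cc'|cc'].
  have [|A mA] := @clique_ext [set c; c'].
    apply/cliqueP=> w z /set2P[] -> /set2P[] ->; rewrite ?eqxx // => _; apply: adjE_Gs => //.
    by rewrite e_sym.
  rewrite subUset !sub1set => /andP[cA cA'].
  apply: Relation_Operators.rt_trans (Hc A mA cA) _; exact: same cA' cT cX2.
(* The end nodes of the minimal path contain [c] and [c'], so they differ from [X], and the tree
   edge of the pair connects them. *)
have [P mP] := min_cover_path_exists c c'.
have go z z' : z \in P -> z' \in P -> c \in z.2 -> c' \in z'.2 -> madj d Gs E' z z' ->
    reach_in (madj d Gs E') N x (true, T).
  move=> zP zP' cz cz' zz'; case: (mP) => [[_ _ nP _] _ _ _].
  have NN w t : w \in P -> t \in w.2 -> t \notin X -> N w.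
    by move=> wP tw tX; split; [exact: nP|move=> Ew; case/negP: tX; move: tw; rewrite Ew].
  have Nz := NN z c zP cz cX1; have Nz' := NN z' c' zP' cz' cX2.
  have [A [mA cA rA]] := attach z c Nz cz; have [A' [mA' cA' rA']] := attach z' c' Nz' cz'.
  apply: Relation_Operators.rt_trans (Hc A mA cA) _.
  apply: Relation_Operators.rt_trans (rsym _ _ rA) _.
  apply: Relation_Operators.rt_trans (step _ _ Nz Nz' zz') _.
  by apply: Relation_Operators.rt_trans rA' _; apply: same cA' cT cX2.
have szP : 0 < size P by case: (mP) => [[P0 _ _ _] _ _ _]; rewrite lt0n size_eq0.
have hP : head nd P \in P by rewrite -nth0 mem_nth.
have lP : last nd P \in P by rewrite -nth_last mem_nth // prednK.
have t : tl_edge d Gs c c' (head nd P) (last nd P) by exists P.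
case: (min_cover_path_ends mP) => -[h l].
  by apply: (go (head nd P) (last nd P)) => //; right; exists c, c'; auto.
by apply: (go (last nd P) (head nd P)) => //; right; exists c, c'; auto.
Qed.

End Augmented.

End SeparatorTree.

(** * Generic points *)

Section Avoid.
Import Reals.
Local Open Scope R_scope.
Variable u : nat -> R.

(** Cantor's nested intervals: each step keeps the outer third on the other side of the midpoint
    from [u k]. *)
Fixpoint nest (n : nat) : R * R :=
  if n is S k then
    let ab := nest k in
    if Rle_dec (u k) ((fst ab + snd ab) / 2)
    then ((fst ab + 2 * snd ab) / 3, snd ab) else (fst ab, (2 * fst ab + snd ab) / 3)
  else (0, 1).

Lemma nest_step n : fst (nest n) < snd (nest n) ->
  [/\ fst (nest n) <= fst (nest n.+1), snd (nest n.+1) <= snd (nest n),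
      fst (nest n.+1) < snd (nest n.+1) &
      u n < fst (nest n.+1) \/ snd (nest n.+1) < u n].
Proof. by move=> lt /=; case: Rle_dec => H /=; split; Lra.lra. Qed.

Lemma nest_lt n : fst (nest n) < snd (nest n).
Proof. by elim: n => [|n /nest_step[]//] /=; Lra.lra. Qed.

Lemma nest_mono n k :
  fst (nest n) <= fst (nest (n + k)%nat) /\ snd (nest (n + k)%nat) <= snd (nest n).
Proof.
elim: k => [|k [IH1 IH2]]; first by rewrite addn0; Lra.lra.
by rewrite addnS; case: (nest_step (nest_lt (n + k)%nat)) => *; Lra.lra.
Qed.

Lemma nest_cross n k : fst (nest n) < snd (nest k).
Proof.
have [H1 _] := nest_mono n k; have [_ H2] := nest_mono k n.
have := nest_lt (n + k)%nat; rewrite addnC in H2; Lra.lra.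
Qed.

Lemma real_not_enumerated : exists t, forall k, u k <> t.
Proof.
(* The supremum [t] of the left ends lies in every interval, whereas [u k] lies outside interval
   [k.+1]. *)
have [||t [ub lub]] := completeness (fun x => exists n, x = fst (nest n)).
- by exists 1 => x [n ->]; have := nest_cross n 0; rewrite /=; Lra.lra.
- by exists 0, 0%nat.
exists t => k E.
have lo : fst (nest k.+1) <= t by apply: ub; exists k.+1.
have hi : t <= snd (nest k.+1).
  by apply: lub => x [n ->]; have := nest_cross n k.+1; Lra.lra.
by case: (nest_step (nest_lt k)) => _ _ _ []; Lra.lra.
Qed.

End Avoid.

Section AvoidRoots.
Local Open Scope ring_scope.

Lemma finite_roots (F : fieldType) (p : {poly F}) : p != 0 ->
  exists rs : seq F, forall t, root p t -> t \in rs.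
Proof.
have [n] := ubnP (size p); elim: n p => // n IH p; rewrite ltnS => szp p0.
case: (classic (exists a, root p a)) => [[a ra]|nr]; last first.
  by exists [::] => t rt; case: nr; exists t.
have [q E] := factor_theorem p a ra.
have q0 : q != 0 by apply: contraNneq p0 => q0; rewrite E q0 mul0r.
have [|//|rs H] := IH q.
  by apply: leq_trans szp; rewrite E size_Mmonic ?monicXsubC // size_XsubC addn2.
exists (a :: rs) => t; rewrite E rootM root_XsubC inE => /orP[/H->|->//].
by rewrite orbT.
Qed.

Lemma avoid_roots (q : nat -> {poly R}) : (forall k, q k != 0) ->
  exists t, forall k, ~~ root (q k) t.
Proof.
move=> q0.
have [rs H] : exists rs : nat -> seq R, forall k t, root (q k) t -> t \in rs k.
  exists (fun k => sval (constructive_indefinite_description _ (finite_roots (q0 k)))) => k.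
  by case: constructive_indefinite_description.
(* All roots are listed in one sequence through coded pairs (polynomial, position); numbers coding
   no pair give the dummy value 0. *)
have [t Ht] := real_not_enumerated (fun k =>
  if unpickle k is Some (i, j) then nth 0 (rs i) j else 0).
exists t => k; apply/negP => /H trs.
by apply: (Ht (pickle (k, index t (rs k)))); rewrite pickleK nth_index.
Qed.

End AvoidRoots.

Section Evaluation.
Local Open Scope ring_scope.
Variable n : nat.
Implicit Types (x : 'I_n -> R) (P : {mpoly rat[n]}).

Definition ev x : {mpoly rat[n]} -> R := meval x \o map_mpoly (ratr : rat -> R).

HB.instance Definition _ x := GRing.RMorphism.copy (ev x) (meval x \o map_mpoly (ratr : rat -> R)).

Lemma evE x P : ev x P = \sum_(m <- msupp P) ratr P@_m * \prod_i x i ^+ m i.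
Proof.
rewrite /ev /= /map_mpoly /mmap rmorph_sum /=; apply: eq_bigr => m _.
by rewrite mmap1_id mevalM mevalC mevalX.
Qed.

Lemma evX x i : ev x 'X_i = x i.
Proof. by rewrite /ev /= map_mpolyX mevalXU. Qed.

Lemma mpoly_enumerable : exists f : nat -> {mpoly rat[n]}, forall P, exists k, f k = P.
Proof.
exists (fun k => if (unpickle k : option (seq ('X_{1..n} * rat))) is Some s
  then \sum_(mc <- s) mc.2 *: 'X_[mc.1] else 0) => P.
exists (pickle [seq (m, P@_m) | m <- msupp P]).
by rewrite pickleK big_map [RHS]mpolyE.
Qed.

End Evaluation.

(** * Existence of generic configurations *)

Section GenericPoint.
Local Open Scope ring_scope.

(** A monomial is determined by its exponent in the last variable and its remaining part [m'], so
    every coefficient of [P] can be read off [muni P]. *)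
Lemma muni_eq0 n (P : {mpoly rat[n.+1]}) : muni P = 0 -> P = 0.
Proof.
move=> E; apply/mpolyP=> m; rewrite mcoeff0.
pose m' := [multinom (m (widen_ord (leqnSn n) i)) | i < n].
have : (muni P)`_(m ord_max)@_m' = 0 by rewrite E coef0 mcoeff0.
move <-; rewrite muniE coef_sum [P in LHS]mpolyE !raddf_sum /=; apply: eq_bigr => k _.
rewrite coefZ coefXn mulr_natr mcoeffMn !mcoeffZ !mcoeffX -mulrnAr -mulrnA; congr (_ * _%:R).
have [->|km] := eqVneq k m; first by rewrite !eqxx.
have [Er|//] := eqVneq _ m'; have [El|//] := eqVneq.
case/eqP: km; apply/mnmP=> i; have [j ->|->] := unliftP ord_max i; last by rewrite El.
have := congr1 (fun q : 'X_{1..n} => q j) Er; rewrite /m' !mnmE.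
by have -> : widen_ord (leqnSn n) j = lift ord_max j by apply/val_inj/esym/lift_max.
Qed.

Lemma ev_muni n (x : 'I_n -> R) (t : R) (P : {mpoly rat[n.+1]}) :
  ev (fun i => if unlift ord_max i is Some j then x j else t) P =
  (map_poly (ev x) (muni P)).[t].
Proof.
rewrite evE muniE rmorph_sum horner_sum; apply: eq_bigr => m _ /=.
rewrite map_polyZ map_polyXn hornerZ hornerXn big_ord_recr /= unlift_none mulrA; congr (_ * _).
rewrite -mul_mpolyC rmorphM /= /ev /= map_mpolyC mevalC map_mpolyX mevalX; congr (_ * _).
apply: eq_bigr => i _; rewrite mnmE.
have -> : widen_ord (leqnSn n) i = lift ord_max i by apply/val_inj/esym/lift_max.
by rewrite liftK.
Qed.

(** Given independent [x], each non-zero rational polynomial in one more variable becomes a non-zero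
    univariate real polynomial at [x]. There are countably many of these, so some [t] is a root of
    none. *)
Lemma alg_indep_exists n : exists x : 'I_n -> R, alg_indep_Q x.
Proof.
elim: n => [|n [x ix]].
  (* Without variables there is only one monomial, so [P] is a rational constant. *)
  exists (fun => 0) => P; rewrite [_.@[_]]evE => E; apply/mpolyP=> m; rewrite mcoeff0.
  have m0 k : k = m by apply/mnmP => i; have := ltn_ord i; rewrite ltn0.
  move: E; rewrite (eq_bigr (fun=> ratr P@_m)) => [|k _]; last by rewrite big_ord0 mulr1 (m0 k).
  case: (msupp P) (msupp_uniq P) (mcoeff_msupp P m) => [|k [|k' s]] /=.
  - by move=> _ /esym/negbT; rewrite negbK => /eqP.
  - by move=> _ _; rewrite big_seq1 => /eqP; rewrite fmorph_eq0 => /eqP.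
  by rewrite (m0 k) (m0 k') inE eqxx.
have [f Hf] := mpoly_enumerable n.+1.
have ev0 Q : ev x Q = 0 -> Q = 0 by apply: ix.
have q0 (P : {mpoly rat[n.+1]}) : P != 0 -> map_poly (ev x) (muni P) != 0.
  apply: contra_neq => E; apply: muni_eq0; apply/polyP=> i; rewrite coef0.
  by apply: ev0; rewrite -coef_map E coef0.
have [|t Ht] := @avoid_roots (fun k => if f k == 0 then 1 else map_poly (ev x) (muni (f k))).
  move=> k; case: ifPn => [_|fk0]; [exact: oner_neq0|exact: q0].
exists (fun i => if unlift ord_max i is Some j then x j else t) => P; rewrite -[_.@[_]]/(ev _ P) ev_muni.
have [k <-] := Hf P; have := Ht k; case: eqVneq => // _ nr E; case/negP: nr; exact/rootP.
Qed.

Lemma generic_exists (V : finType) d : exists p : config V d, generic p.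
Proof.
have [x ix] := alg_indep_exists #|{: V * 'I_d}|.
exists (fun v => \row_k x (enum_rank (v, k))) => P.
have -> : coords (fun v => \row_k x (enum_rank (v, k))) = x; last exact: ix.
apply: functional_extensionality => i.
by rewrite /coords mxE -surjective_pairing enum_valK.
Qed.

End GenericPoint.

(** * Generic frameworks *)

Section RationalOffCoordinate.
Local Open Scope ring_scope.
Variables (n : nat) (x : 'I_n -> R) (i : 'I_n).
Implicit Types (r s : R).

(* The values at [x] of rational functions not involving the variable [X_i]. *)
Definition inK r := exists A B : {mpoly rat[n]},
  [/\ ev x B != 0, r = ev x A / ev x B &
      forall x', (forall j, j != i -> x' j = x j) -> ev x' A = ev x A /\ ev x' B = ev x B].

Lemma inK0 : inK 0.
Proof. by exists 0, 1; split=> [||x' _]; rewrite ?rmorph1 ?rmorph0 ?mul0r ?oner_neq0. Qed.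

Lemma inK1 : inK 1.
Proof. by exists 1, 1; split=> [||x' _]; rewrite ?rmorph1 ?divr1 ?oner_neq0. Qed.

Lemma inKD r s : inK r -> inK s -> inK (r + s).
Proof.
move=> [A [B [B0 -> H]]] [A' [B' [B0' -> H']]].
exists (A * B' + A' * B), (B * B'); split=> [||x' /[dup]/H[HA HB] /H'[HA' HB']].
- by rewrite rmorphM mulf_neq0.
- by rewrite rmorphD !rmorphM addf_div.
by rewrite !rmorphD !rmorphM /= HA HB HA' HB'.
Qed.

Lemma inKN r : inK r -> inK (- r).
Proof.
move=> [A [B [B0 -> H]]]; exists (- A), B; split=> // [|x' /H[HA HB]].
  by rewrite rmorphN mulNr.
by rewrite !rmorphN /= HA HB.
Qed.

Lemma inKM r s : inK r -> inK s -> inK (r * s).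
Proof.
move=> [A [B [B0 -> H]]] [A' [B' [B0' -> H']]].
exists (A * A'), (B * B'); split=> [||x' /[dup]/H[HA HB] /H'[HA' HB']].
- by rewrite rmorphM mulf_neq0.
- by rewrite !rmorphM mulf_div.
by rewrite !rmorphM /= HA HB HA' HB'.
Qed.

Lemma inKV r : inK r -> inK r^-1.
Proof.
have [->|r0] := eqVneq r 0; first by rewrite invr0.
move=> [A [B [B0 E H]]]; exists B, A; split=> [||x' /H[]//].
  by apply: contra_neq r0 => A0; rewrite E A0 mul0r.
by rewrite E invf_div.
Qed.

Lemma inKX j : j != i -> inK (x j).
Proof.
move=> ji; exists 'X_j, 1; split=> [||x' H]; rewrite ?rmorph1 ?divr1 ?oner_neq0 ?evX //.
by rewrite H.
Qed.

(** If [x i] were [A / B], then [A - 'X_i * B] would vanish at [x], hence identically. Raising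
    coordinate [i] by 1 leaves the values of [A] and [B] unchanged and gives [B = 0] there. *)
Lemma inK_notin : alg_indep_Q x -> ~ inK (x i).
Proof.
move=> ix [A [B [B0 E H]]].
have E' : x i * ev x B = ev x A by rewrite E mulfVK.
have z : A - 'X_i * B = 0.
  by apply: ix; rewrite -[_.@[_]]/(ev x _) rmorphB rmorphM /= evX E' subrr.
pose x' j := if j == i then x i + 1 else x j.
have [|HA HB] := H x'; first by move=> j ji; rewrite /x' (negbTE ji).
have : ev x' (A - 'X_i * B) = 0 by rewrite z rmorph0.
rewrite rmorphB rmorphM /= evX HA HB {1}/x' eqxx mulrDl E' mul1r opprD addrA subrr sub0r.
by move/eqP; rewrite oppr_eq0 (negbTE B0).
Qed.

End RationalOffCoordinate.

(** * Scalar products, isometries and reflections *)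

Section Dot.
Local Open Scope ring_scope.
Variable d : nat.
Implicit Types (x y z w : 'rV[R]_d) (A : 'M[R]_d).

Definition dot x y : R := (x *m y^T) 0 0.
Definition dsq x y : R := dot (x - y) (x - y).

Lemma dotE x y : dot x y = \sum_k x 0 k * y 0 k.
Proof. by rewrite /dot mxE; apply: eq_bigr => k _; rewrite mxE. Qed.

Lemma dotC x y : dot x y = dot y x.
Proof. by rewrite !dotE; apply: eq_bigr => k _; rewrite mulrC. Qed.

Lemma dotDl x y z : dot (x + y) z = dot x z + dot y z.
Proof. by rewrite /dot mulmxDl mxE. Qed.

Lemma dotDr x y z : dot z (x + y) = dot z x + dot z y.
Proof. by rewrite !(dotC z) dotDl. Qed.

Lemma dotZl a x y : dot (a *: x) y = a * dot x y.
Proof. by rewrite /dot -scalemxAl mxE. Qed.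

Lemma dotZr a x y : dot x (a *: y) = a * dot x y.
Proof. by rewrite !(dotC x) dotZl. Qed.

Lemma dotNl x y : dot (- x) y = - dot x y.
Proof. by rewrite -scaleN1r dotZl mulN1r. Qed.

Lemma dotNr x y : dot x (- y) = - dot x y.
Proof. by rewrite !(dotC x) dotNl. Qed.

Definition dot_lin := (dotDl, dotDr, dotZl, dotZr, dotNl, dotNr).

Lemma dot_ge0 x : 0 <= dot x x.
Proof. by rewrite dotE; apply: sumr_ge0 => k _; rewrite -expr2 sqr_ge0. Qed.

Lemma dot_eq0 x : dot x x = 0 -> x = 0.
Proof.
rewrite dotE => /eqP; rewrite psumr_eq0 => [/allP H|k _]; last by rewrite -expr2 sqr_ge0.
apply/rowP=> k; rewrite mxE; apply/eqP.
by have := H k (mem_index_enum _); rewrite -expr2 sqrf_eq0.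
Qed.

Lemma dsqE x y : dsq x y = dot x x + dot y y - 2 * dot x y.
Proof. by rewrite /dsq !dot_lin (dotC y x); ring. Qed.

Lemma dsqC x y : dsq x y = dsq y x.
Proof. by rewrite !dsqE (dotC x y); ring. Qed.

Lemma eucl_dist_eq x y z w : eucl_dist x y = eucl_dist z w <-> dsq x y = dsq z w.
Proof.
have E (a b : 'rV[R]_d) : \sum_(k < d) (a 0 k - b 0 k) ^+ 2 = dsq a b :> R.
  by rewrite /dsq dotE; apply: eq_bigr => k _; rewrite !mxE expr2.
rewrite /eucl_dist !E; split=> [/eqP|->//].
by rewrite eqr_sqrt ?dot_ge0 // => /eqP.
Qed.

Definition is_ortho A := A *m A^T = 1%:M.

Lemma is_orthoT A : is_ortho A -> is_ortho A^T.
Proof. by rewrite /is_ortho trmxK; apply: mulmx1C. Qed.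

Lemma dsq_isometry A b x y : is_ortho A -> dsq (x *m A + b) (y *m A + b) = dsq x y.
Proof.
move=> oA; rewrite /dsq /dot opprD addrACA subrr addr0 -mulmxBl trmx_mul mulmxA.
by rewrite -(mulmxA _ A) oA mulmx1.
Qed.

(* The reflection in the hyperplane [{z | dot z n = 1}]. *)
Definition refl_mx n : 'M[R]_d := 1%:M - (2 / dot n n) *: (n^T *m n).
Definition refl_vec n : 'rV[R]_d := (2 / dot n n) *: n.
Definition refl n z : 'rV[R]_d := z *m refl_mx n + refl_vec n.

Lemma reflE n z : refl n z = z + (2 * (1 - dot z n) / dot n n) *: n.
Proof.
rewrite /refl /refl_mx /refl_vec mulmxBr mulmx1 -scalemxAr mulmxA.
rewrite [z *m n^T]mx11_scalar mul_scalar_mx -/(dot z n) scalerA -addrA; congr (_ + _).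
rewrite addrC -scalerBl; congr (_ *: _); ring.
Qed.

Lemma refl_ortho n : n != 0 -> is_ortho (refl_mx n).
Proof.
move=> n0; have nn : dot n n != 0 by apply: contra_neq n0 => /dot_eq0.
have sy : (refl_mx n)^T = refl_mx n.
  by rewrite /refl_mx linearB /= trmx1 linearZ /= trmx_mul trmxK.
rewrite /is_ortho sy {2}/refl_mx mulmxBr mulmx1 -scalemxAr /refl_mx mulmxBl mul1mx.
rewrite -scalemxAl mulmxA -(mulmxA _ n) [n *m n^T]mx11_scalar -/(dot n n).
rewrite mul_mx_scalar -scalemxAl !scalerA mulfVK // scalerBr scalerA -[RHS]addr0 -addrA; congr (_ + _).
rewrite -opprD -scalerBl -scalerDl; apply/eqP; rewrite oppr_eq0 scaler_eq0; apply/orP; left; apply/eqP.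
by field.
Qed.

Lemma refl_fix n z : dot z n = 1 -> refl n z = z.
Proof. by move=> E; rewrite reflE E subrr mulr0 mul0r scale0r addr0. Qed.

End Dot.

(** * Hyperplanes through generic positions *)

Section GenericFrameworks.
Local Open Scope ring_scope.
Variables (V : finType) (d : nat) (p : config V d).
Hypotheses (d_gt0 : (0 < d)%N) (gen : generic p).
Implicit Types (W N : {set V}) (r s : R).

(* The rational functions of the positions of the vertices in [W]. *)
Definition rat_over W r :=
  forall v (k : 'I_d), v \notin W -> inK (coords p) (enum_rank (v, k)) r.

Definition mx_over W m n (A : 'M[R]_(m, n)) := forall i j, rat_over W (A i j).

Lemma coordsE v k : coords p (enum_rank (v, k)) = p v 0 k.
Proof. by rewrite /coords enum_rankK. Qed.

Lemma rat_over_sub W W' r : W \subset W' -> rat_over W r -> rat_over W' r.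
Proof. by move=> /subsetP sub H v k vW; apply: H; apply: contra vW; apply: sub. Qed.

Lemma rat_over0 W : rat_over W 0. Proof. by move=> v k _; apply: inK0. Qed.
Lemma rat_over1 W : rat_over W 1. Proof. by move=> v k _; apply: inK1. Qed.
Lemma rat_overD W r s : rat_over W r -> rat_over W s -> rat_over W (r + s).
Proof. by move=> Hr Hs v k vW; apply: inKD; [apply: Hr|apply: Hs]. Qed.
Lemma rat_overN W r : rat_over W r -> rat_over W (- r).
Proof. by move=> Hr v k vW; apply: inKN; apply: Hr. Qed.
Lemma rat_overM W r s : rat_over W r -> rat_over W s -> rat_over W (r * s).
Proof. by move=> Hr Hs v k vW; apply: inKM; [apply: Hr|apply: Hs]. Qed.
Lemma rat_overV W r : rat_over W r -> rat_over W r^-1.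
Proof. by move=> Hr v k vW; apply: inKV; apply: Hr. Qed.
Lemma rat_overX W v k : v \in W -> rat_over W (p v 0 k).
Proof.
move=> vW u l uW; rewrite -coordsE; apply: inKX; rewrite (inj_eq enum_rank_inj).
by apply: contraNneq uW => -[<- _].
Qed.

Lemma rat_over_sum W (I : Type) (t : seq I) (P : pred I) (F : I -> R) :
  (forall i, P i -> rat_over W (F i)) -> rat_over W (\sum_(i <- t | P i) F i).
Proof. by move=> H; apply: (big_ind (rat_over W)) => //; [exact: rat_over0|exact: rat_overD]. Qed.

Lemma rat_over_prod W (I : Type) (t : seq I) (P : pred I) (F : I -> R) :
  (forall i, P i -> rat_over W (F i)) -> rat_over W (\prod_(i <- t | P i) F i).
Proof. by move=> H; apply: (big_ind (rat_over W)) => //; [exact: rat_over1|exact: rat_overM]. Qed.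

Lemma rat_over_sign W n : rat_over W ((-1) ^+ n).
Proof. by elim: n => [|n IH]; rewrite ?expr0 ?exprS; [exact: rat_over1|apply: rat_overM => //; apply/rat_overN/rat_over1]. Qed.

Lemma rat_over2 W : rat_over W 2.
Proof. by rewrite mulr2n; apply: rat_overD; exact: rat_over1. Qed.

Lemma mx_over_sub W W' m n (A : 'M_(m, n)) : W \subset W' -> mx_over W A -> mx_over W' A.
Proof. by move=> sub HA i j; apply: rat_over_sub (HA i j). Qed.
Lemma mx_overM W m n l (A : 'M_(m, n)) (B : 'M_(n, l)) :
  mx_over W A -> mx_over W B -> mx_over W (A *m B).
Proof. by move=> HA HB i j; rewrite mxE; apply: rat_over_sum => k _; apply: rat_overM. Qed.
Lemma mx_overD W m n (A B : 'M_(m, n)) : mx_over W A -> mx_over W B -> mx_over W (A + B).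
Proof. by move=> HA HB i j; rewrite mxE; apply: rat_overD. Qed.
Lemma mx_overN W m n (A : 'M_(m, n)) : mx_over W A -> mx_over W (- A).
Proof. by move=> HA i j; rewrite mxE; apply: rat_overN. Qed.
Lemma mx_overZ W m n a (A : 'M_(m, n)) : rat_over W a -> mx_over W A -> mx_over W (a *: A).
Proof. by move=> Ha HA i j; rewrite mxE; apply: rat_overM. Qed.
Lemma mx_overT W m n (A : 'M_(m, n)) : mx_over W A -> mx_over W A^T.
Proof. by move=> HA i j; rewrite mxE; apply: HA. Qed.
Lemma mx_over0 W m n : mx_over W (0 : 'M_(m, n)).
Proof. by move=> i j; rewrite mxE; apply: rat_over0. Qed.
Lemma mx_over1 W n : mx_over W (1%:M : 'M_n).
Proof. by move=> i j; rewrite mxE; case: eqP => _; [exact: rat_over1|exact: rat_over0]. Qed.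
Lemma mx_over_p W v : v \in W -> mx_over W (p v).
Proof. by move=> vW i j; rewrite ord1; apply: rat_overX. Qed.
Lemma rat_over_dot W (x y : 'rV_d) : mx_over W x -> mx_over W y -> rat_over W (dot x y).
Proof. by move=> Hx Hy; apply: mx_overM => //; apply: mx_overT. Qed.

Lemma rat_over_det W n (A : 'M_n) : mx_over W A -> rat_over W (\det A).
Proof.
move=> HA; apply: rat_over_sum => s _; apply: rat_overM; first exact: rat_over_sign.
by apply: rat_over_prod.
Qed.

Lemma mx_overV W n (A : 'M_n) : mx_over W A -> mx_over W (invmx A).
Proof.
move=> HA; rewrite /invmx; case: ifP => _ //; apply: mx_overZ.
  exact/rat_overV/rat_over_det.
move=> i j; rewrite mxE; apply: rat_overM; first exact: rat_over_sign.
by apply: rat_over_det => k l; rewrite !mxE.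
Qed.

(** A non-zero coefficient would let one solve for a coordinate of [p v] in terms of the others,
    against [inK_notin]. *)
Lemma generic_linear W v (a : 'rV_d) b : v \notin W -> mx_over W a -> rat_over W b ->
  dot a (p v) + b = 0 -> a = 0.
Proof.
move=> vW Ha Hb E; apply/rowP=> k; rewrite mxE; apply/eqP; apply: contraT => ak.
case: (@inK_notin _ (coords p) (enum_rank (v, k)) gen).
have -> : coords p (enum_rank (v, k)) = - (b + \sum_(j | j != k) a 0 j * p v 0 j) / a 0 k.
  rewrite coordsE; apply: (mulIf ak); rewrite mulfVK //; move: E.
  rewrite dotE (bigD1 k) //= -addrA => /eqP; rewrite addr_eq0 => /eqP E'.
  by rewrite mulrC E' addrC.
apply: inKM; last by apply/inKV/Ha.
apply/inKN/inKD; first exact: Hb.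
elim/big_rec: _ => [|j y jk Hy]; first exact: inK0.
apply: inKD => //; apply: inKM; first exact: Ha.
rewrite -coordsE; apply: inKX; rewrite (inj_eq enum_rank_inj).
by apply: contra jk => /eqP[->].
Qed.

(** For [d] vertices [N], the hyperplane through their positions misses the origin and is scaled to
    the equation [dot z n = 1]. The second clause says that these positions span the space, the last
    one that no other vertex lies on the hyperplane. *)
Definition normal N n := [/\ {in N, forall x, dot (p x) n = 1},
  forall w c, {in N, forall x, dot (p x) w = c} -> w = c *: n, mx_over N n &
  forall b, b \notin N -> dot (p b) n != 1].

Lemma listing N : #|N| = d -> exists2 f : 'I_d -> V, injective f & forall x, (x \in N) = (x \in codom f).
Proof.
move=> cN; have [v0 _] : exists v, v \in N by apply/set0Pn; rewrite -card_gt0 cN.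
have sz : size (enum N) = d by rewrite -cardE.
exists (fun i : 'I_d => nth v0 (enum N) i).
  by move=> i j /eqP; rewrite nth_uniq ?sz ?enum_uniq // => /eqP/val_inj.
move=> x; apply/idP/codomP => [xN|[i ->]]; last by rewrite -mem_enum mem_nth ?sz.
have lt : (index x (enum N) < d)%N by rewrite -[X in (_ < X)%N]sz index_mem mem_enum.
by exists (Ordinal lt); rewrite /= nth_index ?mem_enum.
Qed.

Lemma normal_exists N : #|N| = d -> exists n, normal N n.
Proof.
move=> cN; have [f injf Nf] := listing cN.
have fN i : f i \in N by rewrite Nf codom_f.
pose P : 'M[R]_d := \matrix_(i, k) p (f i) 0 k.
pose M : 'M[{mpoly rat[#|{: V * 'I_d}|]}]_d := \matrix_(i, k) 'X_(enum_rank (f i, k)).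
have uP : P \in unitmx.
  rewrite unitmxE unitfE; apply/eqP => P0.
  have evM (q : config V d) : ev (coords q) (\det M) = \det (\matrix_(i, k) q (f i) 0 k).
    rewrite -det_map_mx; congr (\det _); apply/matrixP=> i k.
    by rewrite !mxE /= evX /coords enum_rankK.
  have M0 : \det M = 0 by apply: gen; rewrite -[_.@[_]]/(ev (coords p) _) evM.
  (* Placing the vertices [f i] at the standard basis gives determinant 1, so [\det M] is not the
     zero polynomial. *)
  pose q : config V d := fun v => \row_k (if [pick i | f i == v] is Some i then (i == k)%:R else 0).
  have := evM q; rewrite M0 rmorph0.
  have -> : \matrix_(i, k) q (f i) 0 k = 1%:M.
    apply/matrixP=> i k; rewrite !mxE; case: pickP => [j /eqP/injf->//|/(_ i)].
    by rewrite eqxx.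
  by rewrite det1 => /eqP; rewrite eq_sym oner_eq0.
pose c1 : 'cV[R]_d := const_mx 1.
pose n := (invmx P *m c1)^T.
have PwE (w : 'rV[R]_d) i : (P *m w^T) i 0 = dot (p (f i)) w.
  by rewrite dotE mxE; apply: eq_bigr => k _; rewrite !mxE.
have n1 : {in N, forall x, dot (p x) n = 1}.
  move=> x; rewrite Nf => /codomP[i ->].
  by rewrite -PwE trmxK mulKVmx // mxE.
have nK : mx_over N n.
  apply/mx_overT/mx_overM; last by move=> i j; rewrite mxE; apply: rat_over1.
  by apply: mx_overV => i k; rewrite mxE; apply: rat_overX.
exists n; split=> // [w c H|b bN].
  apply: trmx_inj; rewrite linearZ /= trmxK -[w^T](mulKmx uP) scalemxAr; congr (_ *m _).
  by apply/colP=> i; rewrite PwE H // !mxE mulr1.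
apply/eqP=> E; have n0 : n = 0.
  have := generic_linear bN nK (rat_overN (@rat_over1 N)).
  by apply; rewrite dotC E subrr.
have := n1 _ (fN (Ordinal d_gt0)); rewrite n0 /dot linear0 mulmx0 mxE => /eqP.
by rewrite eq_sym oner_eq0.
Qed.

Section WithNormal.
Variables (N : {set V}) (n : 'rV[R]_d).
Hypotheses (cN : #|N| = d) (nN : normal N n).

Lemma normal_neq0 : n != 0.
Proof.
have [x xN] : exists x, x \in N by apply/set0Pn; rewrite -card_gt0 cN.
case: nN => n1 _ _ _; have := n1 x xN; apply: contra_eq_neq => ->.
by rewrite /dot linear0 mulmx0 mxE eq_sym oner_eq0.
Qed.

Lemma dot_normal_neq0 : dot n n != 0.
Proof. by apply: contra_neq normal_neq0 => /dot_eq0. Qed.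

(** Equal distances give [y - z] the same product with every [p x], so it is a multiple [c *: n].
    The quadratic equation for [c] has as roots 0 and the value for the reflection of [z]. *)
Lemma equidistant y z : {in N, forall x, dsq y (p x) = dsq z (p x)} -> y = z \/ y = refl n z.
Proof.
move=> H; case: nN => _ span _ _.
have /span E : {in N, forall x, dot (p x) (y - z) = (dot y y - dot z z) / 2}.
  move=> x xN; have := H x xN; rewrite !dsqE !dot_lin (dotC y) (dotC z) => E.
  by lra.
set c := _ / 2 in E; have yE : y = z + c *: n by rewrite -E addrC subrK.
have cE : c * (2 * dot z n + c * dot n n - 2) = 0.
  have : 2 * c = dot y y - dot z z by rewrite /c; field.
  by rewrite {1 2}yE !dot_lin (dotC n z) => E'; lra.
have [c0|c0] := eqVneq c 0; first by left; rewrite yE c0 scale0r addr0.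
right; rewrite reflE yE; congr (_ + _ *: _).
move/eqP: cE; rewrite mulf_eq0 (negbTE c0) /= => /eqP cE.
apply: (mulIf dot_normal_neq0); rewrite mulfVK ?dot_normal_neq0 //.
by lra.
Qed.

(** The points equidistant from [z] and a distinct mirror image form the hyperplane itself, and
    [p b] is not on it. *)
Lemma refl_moves b z : b \notin N -> dsq (refl n z) (p b) = dsq z (p b) -> refl n z = z.
Proof.
case: nN => _ _ _ nb bN; have {}nb := nb b bN; rewrite reflE; set c := _ / _ => E.
have cE : c * (2 * dot z n + c * dot n n - 2 * dot (p b) n) = 0.
  move: E; rewrite !dsqE !dot_lin (dotC n z) (dotC n (p b)) => E.
  by lra.
have cn : c * dot n n = 2 * (1 - dot z n) by rewrite /c mulfVK ?dot_normal_neq0.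
move/eqP: cE; rewrite mulf_eq0 => /orP[/eqP->|/eqP]; first by rewrite scale0r addr0.
rewrite cn => E'; case/eqP: nb; by lra.
Qed.

Lemma refl_fixN x : x \in N -> refl n (p x) = p x.
Proof. by case: nN => n1 _ _ _ /n1; apply: refl_fix. Qed.

Lemma refl_p_neq a : a \notin N -> refl n (p a) != p a.
Proof.
case: nN => _ _ _ nb /nb na; rewrite reflE -subr_eq0 addrAC subrr add0r scaler_eq0.
rewrite (negbTE normal_neq0) orbF !mulf_eq0 invr_eq0 (negbTE dot_normal_neq0) orbF.
by rewrite pnatr_eq0 /= subr_eq0 eq_sym.
Qed.

Lemma mx_over_refl : mx_over N (refl_mx n) /\ mx_over N (refl_vec n).
Proof.
case: nN => _ _ nK _.
have c : rat_over N (2 / dot n n).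
  by apply: rat_overM; [exact: rat_over2|exact/rat_overV/rat_over_dot].
split; last exact: mx_overZ.
apply: mx_overD; first exact: mx_over1.
by apply/mx_overN/mx_overZ => //; apply: mx_overM => //; apply: mx_overT.
Qed.

End WithNormal.

(* Reflecting one side of a [d]-separator preserves all edge lengths. *)
Lemma separated_flexible (H : rel V) N u v : ssrbool.symmetric H -> #|N| = d -> u \notin N -> v \notin N ->
    ~~ conn H (~: N) u v ->
  exists q : config V d, (forall a b, H a b -> dsq (q a) (q b) = dsq (p a) (p b)) /\
    dsq (q u) (q v) != dsq (p u) (p v).
Proof.
move=> Hs cN uN vN uv; have [n nN] := normal_exists cN.
have iso x y : dsq (refl n x) (refl n y) = dsq x y.
  exact: dsq_isometry (refl_ortho (normal_neq0 cN nN)).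
pose q a := if conn H (~: N) u a then refl n (p a) else p a.
have qN x : x \in N -> q x = refl n (p x).
  by move=> xN; rewrite /q; case: ifP => // _; rewrite (refl_fixN nN xN).
have qNp x : x \in N -> q x = p x.
  by move=> xN; rewrite (qN x xN) (refl_fixN nN xN).
have cr a b : H a b -> conn H (~: N) u a -> b \notin N -> conn H (~: N) u b.
  move=> ab ua bN; apply: conn_trans (ua) _; apply: conn1; rewrite ?inE //.
  by have := conn_mem _ ua; rewrite !inE; apply.
exists q; split=> [a b ab|].
  (* The reflection fixes an end in [N], so that end may be treated as moved or unmoved, whichever
     suits the other end. *)
  have [bN|bN] := boolP (b \in N).
    rewrite {1}/q; case: ifP => _; first by rewrite (qN b bN) iso.
    by rewrite (qNp b bN).
  have [aN|aN] := boolP (a \in N).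
    rewrite {2}/q; case: ifP => _; first by rewrite (qN a aN) iso.
    by rewrite (qNp a aN).
  have E : conn H (~: N) u a = conn H (~: N) u b.
    by apply/idP/idP => /cr; apply=> //; rewrite Hs.
  by rewrite /q E; case: ifP.
rewrite /q (negbTE uv) [conn _ _ u u]connect0; apply/eqP => /(refl_moves cN nN vN) E.
by have := refl_p_neq cN nN uN; rewrite E eqxx.
Qed.

(** The difference vectors from [x0] have equal Gram matrices in [p] and [q]. Those of [p] are
    independent, so [invmx (D p) *m D q] is orthogonal and its transpose carries [q] to [p] on [W],
    up to a translation. *)
Lemma clique_isometry W (q : config V d) : #|W| = d.+1 ->
    {in W &, forall a b, dsq (q a) (q b) = dsq (p a) (p b)} ->
  exists A b, is_ortho A /\ {in W, forall x, q x *m A + b = p x}.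
Proof.
move=> cW qp.
have [x0 x0W] : exists x, x \in W by apply/set0Pn; rewrite -card_gt0 cW.
have cN : #|W :\ x0| = d by move: cW; rewrite (cardsD1 x0) x0W => -[].
have [n nN] := normal_exists cN; have [f injf Nf] := listing cN.
have fW i : f i \in W by have := Nf (f i); rewrite codom_f => /setD1P[].
pose D (r : config V d) : 'M[R]_d := \matrix_i (r (f i) - r x0).
have dotD (r : config V d) i j : (D r *m (D r)^T) i j = dot (r (f i) - r x0) (r (f j) - r x0).
  by rewrite dotE mxE; apply: eq_bigr => k _; rewrite !mxE.
have gram : D q *m (D q)^T = D p *m (D p)^T.
  apply/matrixP=> i j; rewrite !dotD.
  have E (r : config V d) a b c : dot (r a - r c) (r b - r c) =
      (dsq (r a) (r c) + dsq (r b) (r c) - dsq (r a) (r b)) / 2.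
    by rewrite !dsqE !dot_lin (dotC (r c) (r b)); lra.
  by rewrite !E !qp.
(* A vector [w] orthogonal to all differences has constant product [c] with the positions of [W], so
   [w = c *: n]. At [x0] this reads [c = c * dot (p x0) n], where the last factor is not 1. *)
have uP : D p \in unitmx.
  rewrite -unitmx_tr -row_free_unit; apply: inj_row_free => w w0.
  case: nN => _ span _ nb.
  have E : w = dot (p x0) w *: n.
    apply: span => x; rewrite Nf => /codomP[i ->]; apply/eqP; rewrite -subr_eq0.
    have -> : dot (p (f i)) w - dot (p x0) w = (w *m (D p)^T) 0 i.
      rewrite -dotNl -dotDl dotC dotE mxE; apply: eq_bigr => k _; by rewrite !mxE.
    by rewrite w0 mxE.
  have := congr1 (dot (p x0)) E; rewrite dotZr -{1}[dot _ _]mulr1 => /eqP.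
  rewrite -subr_eq0 -mulrBr mulf_eq0 subr_eq0 [1 == _]eq_sym.
  rewrite (negbTE (nb x0 _)) ?orbF; last by rewrite !inE eqxx.
  by move=> /eqP E0; rewrite E E0 scale0r.
pose B := invmx (D p) *m D q.
have oB : is_ortho B.
  rewrite /is_ortho /B trmx_mul mulmxA -(mulmxA _ (D q)) gram !mulmxA mulVmx // mul1mx.
  by rewrite trmx_inv mulmxV // unitmx_tr.
exists B^T, (p x0 - q x0 *m B^T); split; first exact: is_orthoT.
move=> x xW; rewrite addrCA -mulmxBl.
have [->|xx0] := eqVneq x x0; first by rewrite subrr mul0mx addr0.
have : x \in W :\ x0 by apply/setD1P.
rewrite Nf => /codomP[i ->].
have -> : q (f i) - q x0 = row i (D q) by rewrite rowK.
have -> : D q = D p *m B by rewrite mulKVmx.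
by rewrite row_mul -mulmxA oB mulmx1 rowK addrC subrK.
Qed.

End GenericFrameworks.

(** * Equivalent realizations of a chordal graph *)

Section EquivalentRealizations.
Local Open Scope ring_scope.
Variables (V : finType) (d : nat) (p q : config V d) (e : rel V).
Hypotheses (d_gt0 : (0 < d)%N) (gen : generic p).
Hypotheses (e_sym : ssrbool.symmetric e) (ch : chordal_rel e).
Hypothesis qp : forall a b, e a b -> dsq (q a) (q b) = dsq (p a) (p b).
Implicit Types (W N M Q X : {set V}) (r : config V d).

Definition same_dist : rel V := [rel a b | dsq (q a) (q b) == dsq (p a) (p b)].
Local Notation H := same_dist.

Lemma same_dist_sym : ssrbool.symmetric H.
Proof. by move=> a b; rewrite /same_dist /= (dsqC (q a)) (dsqC (p a)). Qed.

Definition dconn_on W := forall X, (#|X| < d)%N ->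
  {in W :\: X &, forall u v, conn e (W :\: X) u v}.

(** The invariant of the elimination: the isometry from [p] to [r] may change from clique to clique,
    but it is always rational in the positions of [W]. *)
Definition piecewise_rat W r := forall M, M \subset W -> cliqueb e M ->
  exists A b, [/\ is_ortho A, mx_over p W A, mx_over p W b &
    {in M, forall x, r x = p x *m A + b}].

Definition isometric r := forall a b, dsq (r a) (r b) = dsq (q a) (q b).

Lemma piecewise_rat_isometry W r A b : is_ortho A -> mx_over p W A -> mx_over p W b ->
  piecewise_rat W r -> piecewise_rat W (fun v => r v *m A + b).
Proof.
move=> oA KA Kb fr M MW cM; have [A0 [b0 [oA0 KA0 Kb0 E]]] := fr M MW cM.
exists (A0 *m A), (b0 *m A + b); split.
- by rewrite /is_ortho trmx_mul mulmxA -(mulmxA A0) oA mulmx1.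
- exact: mx_overM.
- by apply: mx_overD => //; apply: mx_overM.
by move=> x /E->; rewrite mulmxDl mulmxA addrA.
Qed.

Lemma piecewise_rat_mem W r v : piecewise_rat W r -> v \in W -> mx_over p W (r v).
Proof.
move=> fr vW; have [||A [b [_ KA Kb E]]] := fr [set v]; first by rewrite sub1set.
  by apply/cliqueP=> a c /set1P-> /set1P->; rewrite eqxx.
rewrite E ?inE //; apply: mx_overD => //; apply: mx_overM => //; exact: mx_over_p.
Qed.

Lemma subset_of_card N : (d <= #|N|)%N -> exists2 N0 : {set V}, N0 \subset N & #|N0| = d.
Proof.
move=> le; exists [set x in take d (enum N)].
  by apply/subsetP=> x; rewrite inE => xt; rewrite -mem_enum; apply: mem_take xt.
have un : uniq (take d (enum N)) by rewrite take_uniq ?enum_uniq.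
by rewrite cardsE (card_uniqP un) size_takel // -cardE.
Qed.

Lemma isometric_move r A b : isometric r -> is_ortho A -> isometric (fun v => r v *m A + b).
Proof. by move=> ir oA x y; rewrite dsq_isometry. Qed.

(** Otherwise fewer than [d] neighbours would separate [s] from a further vertex of [W]. *)
Lemma simplicial_degree W s : dconn_on W -> (d.+1 < #|W|)%N -> s \in W ->
  (d <= #|[set x in W :\ s | e s x]|)%N.
Proof.
move=> dW szW sW; set N := [set x in _ | _]; rewrite leqNgt; apply/negP=> ltN.
have [v vW] : exists2 v, v \in W & v \notin s |: N.
  apply/subsetPn; apply/negP => /subset_leq_card; rewrite leqNgt.
  by case/negP; apply: leq_trans szW; rewrite cardsU1 ltnS; case: (s \notin N); [apply: leqW|apply/leqW/ltnW].
rewrite !in_setU1 negb_or => /andP[vs vN].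
have sN : s \notin N by rewrite !inE eqxx.
have := dW N ltN s v; rewrite !in_setD sN sW vN vW => /(_ isT isT) c.
case/eqP: vs; move: v c {vW vN}; apply: conn_ind => // a b aW bW ab Ea.
apply: contraTeq bW => bs; rewrite inE negb_and negbK; apply/orP.
by case bW: (b \in W); [left; rewrite !inE bs bW -Ea ab|right].
Qed.

(** Undoing the isometry on the clique [N] gives [r1] equal to [p] on [N]. Then [r1 s] and [p s]
    have the same distances to [N], so they agree or are mirror images in a hyperplane through [d]
    vertices of [N]; in the latter case everything is reflected. *)
Lemma extend_realization W s r : simplicial e W s ->
    (d <= #|[set x in W :\ s | e s x]|)%N -> isometric r -> piecewise_rat (W :\ s) r ->
  exists r', [/\ isometric r', piecewise_rat (W :\ s) r', r' s = p s &
    {in [set x in W :\ s | e s x], forall x, r' x = p x}].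
Proof.
move=> [sW simp]; set N := [set x in _ | _] => dN ir fr.
have NW : N \subset W :\ s by apply/subsetP=> x; rewrite inE => /andP[].
have NP x : x \in N -> [/\ x \in W, x != s & e s x].
  by rewrite inE => /andP[/setD1P[xs xW] sx].
have cN : cliqueb e N.
  by apply/cliqueP=> a b /NP[aW _ sa] /NP[bW _ sb]; apply: simp.
have [A [b [oA KA Kb E]]] := fr N NW cN.
pose r1 : config V d := fun v => r v *m A^T + - (b *m A^T).
have ir1 : isometric r1 by apply: isometric_move => //; apply: is_orthoT.
have fr1 : piecewise_rat (W :\ s) r1.
  apply: piecewise_rat_isometry => //; first exact: is_orthoT.
    exact: mx_overT.
  by apply/mx_overN/mx_overM => //; apply: mx_overT.
have r1N x : x \in N -> r1 x = p x.
  by move=> /E rx; rewrite /r1 rx mulmxDl addrK -mulmxA oA mulmx1.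
have ds x : x \in N -> dsq (p s) (p x) = dsq (r1 s) (p x).
  by move=> xN; rewrite -{2}(r1N x xN) ir1 qp //; case: (NP x xN).
have [Es|ns] := eqVneq (r1 s) (p s); first by exists r1.
have [N0 N0N cN0] := subset_of_card dN.
have [n nN] := normal_exists d_gt0 gen cN0.
have N0N' x : x \in N0 -> x \in N by move/(subsetP N0N).
have ps : p s = refl n (r1 s).
  have [||//] := equidistant d_gt0 cN0 nN (y := p s) (z := r1 s); last by move=> E'; rewrite E' eqxx in ns.
  by move=> x /N0N'; apply: ds.
(* A vertex of [N] off the hyperplane would rule out the mirror image, so here the reflection fixes
   all of [N]. *)
have NN0 x : x \in N -> x \in N0.
  move=> xN; apply: contraT => xN0.
  have := refl_moves d_gt0 cN0 nN xN0 (z := r1 s); rewrite -ps ds // => /(_ erefl) E'.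
  by rewrite E' eqxx in ns.
have [KR Kv] := mx_over_refl nN.
have sub : N0 \subset W :\ s := subset_trans N0N NW.
exists (fun v => refl n (r1 v)); split.
- apply: isometric_move => //; exact: refl_ortho (normal_neq0 d_gt0 cN0 nN).
- apply: piecewise_rat_isometry => //; [|exact: mx_over_sub KR|exact: mx_over_sub Kv].
  exact: refl_ortho (normal_neq0 d_gt0 cN0 nN).
- by [].
by move=> x xN; rewrite r1N // (refl_fixN nN (NN0 x xN)).
Qed.

(** The first conjunct makes the induction work: it places the vertices other than [s] rationally
    over [W :\ s], and the position of [s] is generic over that field. *)
Lemma rigid_step W : (d < #|W|)%N -> dconn_on W ->
  (exists r, isometric r /\ piecewise_rat W r) /\
  {in W &, forall u v, ~~ H u v -> exists Q, [/\ #|Q| = d, Q \subset W, u \notin Q, v \notin Q &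
    ~~ conn H (W :\: Q) u v]}.
Proof.
have [n] := ubnP #|W|; elim: n W => // n IH W; rewrite ltnS => szn szW dW.
have [/eqP cW|cW] := boolP (#|W| == d.+1).
  (* Deleting the [d - 1] vertices other than [a] and [b] leaves [W] connected, so [a] and [b] are
     adjacent. *)
  have cl : {in W &, forall a b, a != b -> e a b}.
    move=> a b aW bW ab; pose X := W :\ a :\ b.
    have cX : (#|X| < d)%N.
      move: cW; rewrite (cardsD1 a) aW (cardsD1 b (W :\ a)) in_setD1 eq_sym ab bW.
      by rewrite -/X => -[<-].
    have mem c : c \in W :\: X -> (c == a) || (c == b).
      by rewrite /X !inE => /andP[cX' cW']; move: cX'; rewrite cW' andbT negb_and !negbK orbC.
    have : (b == a) || e a b; last by rewrite eq_sym (negbTE ab).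
    have := dW X cX a b; rewrite /X !inE !eqxx aW bW !andbF => /(_ isT isT).
    move=> cab; have : forall c, conn e (W :\: X) a c -> (c == a) || (c == b) && e a b.
      apply: conn_ind => [|c c' cX' cX'' cc]; first by rewrite eqxx.
      case/orP=> [/eqP Ec|/andP[/eqP Ec ab']].
        by case/orP: (mem _ cX'') => /eqP E'; rewrite E' eqxx //= -E' -Ec cc orbT.
      by case/orP: (mem _ cX'') => /eqP ->; rewrite ?eqxx ?ab' ?orbT.
    by move=> /(_ b cab); rewrite eqxx /=.
  have dqp : {in W &, forall a b, dsq (q a) (q b) = dsq (p a) (p b)}.
    move=> a b aW bW; have [->|ab] := eqVneq a b; first by rewrite /dsq !subrr.
    exact/qp/cl.
  split; last by move=> u v uW vW; rewrite /same_dist /= dqp // eqxx.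
  have [A [b [oA E]]] := clique_isometry d_gt0 gen cW dqp.
  exists (fun v => q v *m A + b); split; first by move=> x y; rewrite dsq_isometry.
  move=> M MW _; exists 1%:M, 0; split; [|exact: mx_over1|exact: mx_over0|].
    by rewrite /is_ortho trmx1 mulmx1.
  by move=> x xM; rewrite mulmx1 addr0 E // (subsetP MW).
have {cW} szW' : (d.+1 < #|W|)%N by rewrite ltn_neqAle eq_sym cW.
have [|s simp] := @simplicial_exists V e e_sym ch W; first by rewrite -card_gt0 (leq_ltn_trans _ szW).
have sW := simp.1.
have cWs : #|W| = #|W :\ s|.+1 by rewrite (cardsD1 s) sW.
have [|||[r [ir fr]] sepW'] := IH (W :\ s).
- by rewrite -ltnS -cWs ltnS.
- by move: szW'; rewrite cWs.
- move=> X cX u v; rewrite !in_setD !in_set1 => /and3P[uX us uW] /and3P[vX vs vW].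
  by apply: simplicial_conn => //; apply: dW; rewrite // inE ?uX ?vX.
have dN := simplicial_degree dW szW' sW.
have [r' [ir' fr' r's r'N]] := extend_realization simp dN ir fr.
have sW' : s \notin W :\ s by rewrite !inE eqxx.
have subW : W :\ s \subset W by rewrite subD1set.
split.
  (* A clique containing [s] consists of [s] and neighbours of it, where [r'] is [p]; any other
     clique lies in [W :\ s]. *)
  exists r'; split=> // M MW cM; have [sM|sM] := boolP (s \in M).
    exists 1%:M, 0; split; [|exact: mx_over1|exact: mx_over0|].
      by rewrite /is_ortho trmx1 mulmx1.
    move=> x xM; rewrite mulmx1 addr0; have [->//|xs] := eqVneq x s.
    apply: r'N; rewrite !inE xs (subsetP MW) //=; move/cliqueP: cM; apply=> //.
    by rewrite eq_sym.
  have [|A [b [oA KA Kb E]]] := fr' M _ cM; last first.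
    by exists A, b; split=> //; [apply: mx_over_sub KA|apply: mx_over_sub Kb].
  apply/subsetP=> x xM; rewrite in_setD1 (subsetP MW) // andbT.
  by apply: contraNneq sM => <-.
have Hr' a b : H a b = (dsq (r' a) (r' b) == dsq (p a) (p b)) by rewrite /same_dist /= ir'.
(* [dsq (p s) (r' v) = dsq (p s) (p v)] is affine in [p s], with coefficients rational over [W :\ s]. *)
have Hs v : v \in W :\ s -> H s v = (r' v == p v).
  move=> vW; rewrite Hr' r's; apply/eqP/eqP => [E|->//].
  have := generic_linear gen sW' (a := p v - r' v)
    (b := (dot (r' v) (r' v) - dot (p v) (p v)) / 2).
  move=> L; apply/eqP; rewrite eq_sym -subr_eq0; apply/eqP/L.
  - apply: mx_overD; first exact: mx_over_p.
    exact/mx_overN/piecewise_rat_mem.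
  - apply: rat_overM; last exact/rat_overV/rat_over2.
    apply: rat_overD; first by apply: rat_over_dot; apply: piecewise_rat_mem.
    by apply/rat_overN/rat_over_dot; apply: mx_over_p.
  by move: E; rewrite !dsqE !dot_lin (dotC (p v) (p s)) (dotC (r' v) (p s)) => E; lra.
(* By [Hs] these are the neighbours of [s] in [H]. Since [r'] is [p] on them, the pairs among them
   are preserved and [s] is simplicial in [H]. *)
pose B := [set v in W :\ s | r' v == p v].
have BP v : v \in B -> v \in W :\ s /\ r' v = p v by rewrite inE => /andP[? /eqP].
have simpH : simplicial H W s.
  split=> // a b aW bW sa sb ab.
  have [Ea|a_s] := eqVneq a s; first by rewrite Ea.
  have [Eb|b_s] := eqVneq b s; first by rewrite Eb same_dist_sym.
  move: sa sb; rewrite !Hs ?in_setD1 ?a_s ?b_s // => /eqP Ea /eqP Eb.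
  by rewrite Hr' Ea Eb.
have main v : v \in W -> ~~ H s v -> exists Q, [/\ #|Q| = d, Q \subset W, s \notin Q, v \notin Q &
    ~~ conn H (W :\: Q) s v].
  move=> vW nsv; have vs : v != s by apply: contraNneq nsv => ->; rewrite /same_dist /= /dsq !subrr.
  have vW' : v \in W :\ s by apply/setD1P.
  have vB : v \notin B by apply: contra nsv => /BP[_ E]; rewrite Hs // E.
  case nb : [exists b in B, ~~ H b v].
    (* [s] and [b] are adjacent in [H], so a walk from [s] to [v] extends to one from [b], from
       which [s] can be bypassed; hence the separator of [b] and [v] serves for [s] as well. *)
    case/exists_inP: nb => b bB nbv; have [bW' Eb] := BP b bB.
    have [Q [cQ QW bQ vQ ncQ]] := sepW' b v bW' vW' nbv.
    have sQ : s \notin Q by apply: contra sW'; apply: (subsetP QW).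
    have bs : b != s by case/setD1P: bW'.
    exists Q; split=> //; first exact: subset_trans QW subW.
    apply: contra ncQ => c; apply: simplicial_conn => //; first exact: same_dist_sym.
    apply: conn_trans c; apply: conn1; rewrite ?in_setD ?sQ ?bQ ?sW //; first exact: (subsetP subW).
    by rewrite same_dist_sym Hs // Eb.
  have Bv b : b \in B -> H b v.
    by move=> bB; apply: contraFT nb => nbv; apply/exists_inP; exists b.
  have [N0 N0N cN0] := subset_of_card dN.
  have N0B : N0 \subset B.
    apply: (subset_trans N0N); apply/subsetP=> x xN; rewrite inE r'N // eqxx andbT.
    by move: xN; rewrite inE => /andP[].
  (* The right distance from [v] to a further vertex of [B] would exclude the mirror image and force
     [r' v = p v], that is, [v \in B]. *)
  have BN0 : B = N0.
    apply/eqP; rewrite eqEsubset N0B andbT; apply/subsetP=> b bB; apply: contraT => bN0.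
    have [nn nN] := normal_exists d_gt0 gen cN0.
    have eqd x : x \in B -> dsq (p v) (p x) = dsq (r' v) (p x).
      move=> xB; have [_ Ex] := BP x xB; have := Bv x xB; rewrite same_dist_sym Hr' Ex.
      by move/eqP->.
    case/negP: vB; rewrite inE vW'; apply/eqP.
    have [|//|E] := equidistant d_gt0 cN0 nN (y := p v) (z := r' v).
      by move=> x xN0; apply/eqd/(subsetP N0B).
    by rewrite E; apply/esym/(refl_moves d_gt0 cN0 nN bN0); rewrite -E eqd.
  (* [B] has [d] vertices and contains all neighbours of [s] in [H], so it separates [s] from
     [v]. *)
  exists B; split=> //; first by rewrite BN0.
  - by apply: subset_trans subW; apply/subsetP=> x /BP[].
  - by apply: contra sW' => /BP[].
  apply: contra vs => c; apply/eqP; move: v c {vW nsv vW' vB nb Bv}.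
  apply: conn_ind => // a b aW bW ab Ea; apply: contraTeq bW => bs.
  rewrite in_setD negb_and negbK; case bW: (b \in W); rewrite ?orbT // orbF.
  have bW' : b \in W :\ s by apply/setD1P.
  by rewrite inE bW' -Hs // -Ea.
move=> u v uW vW nuv; have [Eu|us] := eqVneq u s; first by rewrite Eu in nuv *; apply: main.
have [Ev|vs] := eqVneq v s.
  have [|Q [cQ QW sQ uQ nc]] := main u uW; first by rewrite same_dist_sym -Ev.
  exists Q; split=> //; first by rewrite Ev.
  by rewrite (conn_sym _ same_dist_sym) Ev.
have [||Q [cQ QW uQ vQ nc]] := sepW' u v _ _ nuv; try by apply/setD1P.
exists Q; split=> //; first exact: subset_trans QW subW.
apply: contra nc; apply: simplicial_conn => //; exact: same_dist_sym.
Qed.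

End EquivalentRealizations.

(** * Global rigidity and the totally loose closure *)

Section ChordalRigidity.
Variables (V : finType) (d : nat) (E : {set {set V}}).
Implicit Types (F Gs H : {set {set V}}) (Q X : {set V}) (p q : config V d).
Hypotheses (d_gt0 : 0 < d) (sE : simple_graph E) (kE : k_connected d E) (cE : chordal E).

Lemma adj_sym F : ssrbool.symmetric (adj F).
Proof. by move=> a b; rewrite /adj setUC. Qed.

Lemma adj_irr : ssrbool.irreflexive (adj E).
Proof.
by move=> a; apply/negP => /sE; rewrite setUid cards1.
Qed.

Lemma connected_onP F X : connected_on F (~: X) <->
  {in ~: X &, forall u v, conn (adj F) (~: X) u v}.
Proof. by split=> H u v uX vX; apply/reach_conn/H. Qed.

Lemma k_conn X : #|X| < d -> {in ~: X &, forall u v, conn (adj E) (~: X) u v}.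
Proof. by case: kE => _ H /H/connected_onP. Qed.

Lemma equivalent_dsq F p q : equivalent F p q <->
  forall a b, adj F a b -> dsq (q a) (q b) = dsq (p a) (p b).
Proof.
split=> H a b ab; first by apply/esym/eucl_dist_eq/H.
by apply/eucl_dist_eq/esym/H.
Qed.

Lemma changed_separated p q u v : generic p -> equivalent E p q ->
    eucl_dist (p u) (p v) <> eucl_dist (q u) (q v) ->
  exists Q, [/\ #|Q| = d, u \notin Q, v \notin Q & ~~ conn (same_dist p q) (~: Q) u v].
Proof.
move=> gen /equivalent_dsq qp ne.
have [||_ sep] := @rigid_step V d p q (adj E) d_gt0 gen (adj_sym E) cE qp [set: V].
- by rewrite cardsT; case: kE.
- by move=> X cX; rewrite setTD; apply: k_conn.
have [|Q [cQ _ uQ vQ nc]] := sep u v (in_setT _) (in_setT _).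
  by apply/negP=> /eqP E'; apply/ne/eucl_dist_eq/esym.
by exists Q; rewrite -setTD.
Qed.

(** Edges of [F] are preserved pairs, so a set separating [u] from [v] among the preserved pairs
    would separate them in [F]. *)
Lemma preserved_of_connected F p q u v : generic p -> E \subset F -> equivalent F p q ->
    (forall Q, #|Q| = d -> u \notin Q -> v \notin Q -> conn (adj F) (~: Q) u v) ->
  eucl_dist (p u) (p v) = eucl_dist (q u) (q v).
Proof.
move=> gen /subsetP EF qF cF; apply/eqP; apply: contraT => /eqP ne.
have [|Q [cQ uQ vQ /negP[]]] := changed_separated gen _ ne.
  by move=> a b ab; apply/qF/EF.
apply: conn_sub (cF Q cQ uQ vQ) => // a b _ _ ab.
by apply/eqP; move/equivalent_dsq: qF; apply.
Qed.

Lemma separated_not_rigid F p Q u v : generic p -> #|Q| = d -> u \notin Q -> v \notin Q ->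
    ~~ conn (adj F) (~: Q) u v ->
  exists q, equivalent F p q /\ eucl_dist (p u) (p v) <> eucl_dist (q u) (q v).
Proof.
move=> gen cQ uQ vQ nc.
have [q [qF ne]] := separated_flexible d_gt0 gen (adj_sym F) cQ uQ vQ nc.
exists q; split; first exact/equivalent_dsq.
by move/eucl_dist_eq => E'; rewrite E' eqxx in ne.
Qed.

(** The graph [G] of glued pairs is totally loose, so the closure is contained in it. Conversely, a
    glued pair keeps its distance in every framework equivalent on [E] to a generic one, so it
    cannot be loose in [Gs]. *)
Lemma tlc_adj Gs a b : is_tlc d E Gs -> adj Gs a b = (a != b) && glued d E a b.
Proof.
case=> sGs /subsetP EGs tGs minGs.
have gsym c c' : glued d E c c' = glued d E c' c.
  by apply/gluedP/gluedP=> H Q cQ cx cy; rewrite (conn_sym _ (adj_sym E)); apply: H.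
pose G := [set [set ab.1; ab.2] | ab in [pred ab : V * V | (ab.1 != ab.2) && glued d E ab.1 ab.2]].
have adjG u v : adj G u v = (u != v) && glued d E u v.
  apply/imsetP/idP => [[[x y] /andP[/= xy gxy] Exy]|uv]; last by exists (u, v).
  have xuv : x \in [set u; v] by rewrite Exy set21.
  have yuv : y \in [set u; v] by rewrite Exy set22.
  case/set2P: xuv => Ex; case/set2P: yuv => Ey; rewrite -?Ex -?Ey ?xy //; first by rewrite Ex Ey eqxx in xy.
    by rewrite gsym gxy eq_sym xy.
  by rewrite Ex Ey eqxx in xy.
have EG : E \subset G.
  apply/subsetP=> e eE; have /eqP/cards2P[u [v [uv Ee]]] := sE eE.
  rewrite Ee -/(adj G u v) adjG uv /=; apply/gluedP=> Q _ uQ vQ.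
  by apply: conn1; rewrite ?inE // /adj -Ee.
apply/idP/andP=> [ab|[ab gab]].
  apply/andP; rewrite -adjG; apply: (subsetP (minGs G _ EG _)) ab.
    by move=> e /imsetP[[x y] /andP[/= xy _] ->]; rewrite cards2 xy.
  move=> u v uv; rewrite adjG uv /= => /forallPn[Q].
  rewrite !negb_imply => /and4P[/eqP cQ uQ vQ nc] [p [gen H]].
  (* A set [Q] of size [d] never separates a glued pair, so edges of [G] do not cross between
     components of [E] minus [Q]. *)
  have nG : ~~ conn (adj G) (~: Q) u v.
    apply: contra nc => c; move: v c {uv vQ H}.
    apply: conn_ind => [|x y xQ yQ xy ux]; first exact: connect0.
    rewrite !inE in xQ yQ; apply: conn_trans ux _.
    by move: xy; rewrite adjG => /andP[_ /gluedP]; apply.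
  by have [q [qG ne]] := separated_not_rigid gen cQ uQ vQ nG; apply/ne/esym/H.
apply: contraT => nab; case: (tGs a b ab nab).
have [p gen] := generic_exists V d; exists p; split=> // q qGs.
apply/esym/(preserved_of_connected gen (subxx E)).
  by move=> x y xy; apply/qGs/EGs.
exact/gluedP.
Qed.

End ChordalRigidity.

Theorem theorem8p5 (V : finType) (d : nat) (E E' Gs : {set {set V}}) :
  (1 <= d)%N ->
  simple_graph E -> k_connected d E -> chordal E -> (d + 2 <= #|V|)%N ->
  (forall e, e \in E' -> exists u v, [/\ u != v, e = [set u; v] & ~~ adj E u v]) ->
  is_tlc d E Gs ->
  (globally_rigid d (add_edges E E') <-> k_connected d.+1 (add_edges E E')) /\
  (k_connected d.+1 (add_edges E E') <->
     (forall Q : {set V}, separator d Gs Q ->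
        ~ cut_vertex (is_tnode d Gs) (madj d Gs E') (false, Q))).
Proof.
move=> d_gt0 sE kE cE szV _ tlc.
have e_irr := adj_irr sE; have dcon := @k_conn _ _ _ kE.
have gE a b := tlc_adj d_gt0 sE kE cE a b tlc.
set F := add_edges E E'.
(* Deleting fewer than [d] vertices already leaves [E] connected, so only sets of exactly [d]
   vertices matter. *)
have kF : k_connected d.+1 F <->
    forall X : {set V}, #|X| = d -> {in ~: X &, forall u v, conn (adj F) (~: X) u v}.
  split=> [[_ H] X cX|H]; first by apply/connected_onP/H; rewrite cX.
  split=> [|X]; first by rewrite addn2 in szV.
  rewrite ltnS leq_eqVlt => /orP[/eqP/H/connected_onP //|/dcon cX].
  by apply/connected_onP=> u v uX vX; apply/conn_add/cX.
have sepP Q := separatorP e_irr gE Q.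
split; rewrite kF;
  [split=> [[p [gen rig]] X cX u v|H]|split=> [H Q /sepP sQ|H X cX u v uX vX]].
- rewrite !inE => uX vX; apply: contraT => nc.
  by have [q [qF ne]] := separated_not_rigid d_gt0 gen cX uX vX nc; case: ne; apply: rig.
- have [p gen] := generic_exists V d; exists p; split=> // q qF u v.
  apply: (preserved_of_connected d_gt0 kE cE gen _ qF); first exact: subsetUl.
  by move=> Q cQ uQ vQ; apply: H; rewrite ?inE.
- by apply: (no_cut_of_connected (adj_sym E) e_irr cE dcon gE sQ); apply: H; case/dsepP: sQ.
(* A set of [d] vertices that disconnects [F] also disconnects [E], so it is a node of the tree. *)
apply: contraT => nc; have sX : dsep (adj E) d X.
  apply/dsepP; split=> //; exists u, v; split; rewrite -1?in_setC //.
  by apply: contra nc; apply: conn_add.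
case/negP: nc; apply: (connected_of_no_cut (adj_sym E) e_irr cE dcon gE sX) => //.
exact/H/sepP.
Qed.
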